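(* Let $\epsilon\in\{1,-1\}$, let $A_{\mathfrak t}$ be a nondegenerate diagonal real $(n+1)\times(n+1)$ matrix such that $\epsilon A_{\mathfrak t}$ has at least one positive eigenvalue, write $x^{\mathfrak t}y=x^{\mathsf T}A_{\mathfrak t}y$, and let $\mathcal M=\mathbb S^n_{\mathfrak t,\epsilon}:=\{x\in\mathbb R^{n+1}:x^{\mathfrak t}x=\epsilon\}$. Let $\mathsf u$ be a $C^4$ function on an interval with $C^4$ inverse $\mathsf s$, $\mathsf s_i=\mathsf s^{(i)}$, $\mathsf s_0=\mathsf s$, such that $$\big(-\mathsf s_0\mathsf s_1^2+\mathsf s_2(\mathsf s_0^2-1)\big)(\mathsf s_1^2-\mathsf s_2\mathsf s_0)\,\mathsf s_1\ne0$$ at all values $u$ of $\mathsf u$. Let $\mathcal N$ be an open subset of $\mathcal M\times\mathcal M$ (of pairs with $x^{\mathfrak t}\bar x$ in the domain of $\mathsf u$), with cost $\mathsf c(x,\bar x)=\mathsf u(x^{\mathfrak t}\bar x)$. For $(x,\bar x)\in\mathcal N$ put $s=s_0=x^{\mathfrak t}\bar x$, $s_i=\mathsf s_i(\mathsf u(s))$. Then the MTW tensor at a tangent vector $\mathring\xi=(\xi,\bar\xi)\in T_{(x,\bar x)}\mathcal N$ is given by the Gauss-Codazzi equation $$\mathrm{cross}_{\mathbb S^n_{\mathfrak t,\epsilon}}(\mathring\xi)=\mathrm{cross}_{\mathbb R^{n+1}}(\mathring\xi)+\mathcal{II},$$ where $$\mathrm{cross}_{\mathbb R^{n+1}}(\mathring\xi)=\frac{(s_1^2-s_0s_2)s_4+s_0s_3^2-2s_1s_2s_3+s_2^3}{2(s_1^2-s_0s_2)s_1^5}(\xi^{\mathfrak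 t}\bar x\,\bar\xi^{\mathfrak t}x)^2-\frac{2(s_1s_3-s_2^2)}{s_1^4}(\xi^{\mathfrak t}\bar x\,\bar\xi^{\mathfrak t}x)\langle\mathring\xi,\mathring\xi\rangle_{KM}+\frac{s_2}{s_1}\langle\mathring\xi,\mathring\xi\rangle_{KM}^2,$$ and the contribution $\mathcal{II}:=\langle\mathbb{II}(\xi_{*0},\xi_{*0}),\mathbb{II}(\bar\xi_{0*},\bar\xi_{0*})\rangle_{KM}$ of the second fundamental form is $$\mathcal{II}=\frac{\big(-(s_1^2-ss_2)s_1^2\,\xi^{\mathfrak t}\xi+\epsilon(s_2^2-s_3s_1)(\bar x^{\mathfrak t}\xi)^2\big)\big(-(s_1^2-ss_2)s_1^2\,\bar\xi^{\mathfrak t}\bar\xi+\epsilon(s_2^2-s_3s_1)(x^{\mathfrak t}\bar\xi)^2\big)}{2s_1^5(s_1^2-ss_2)(-ss_1^2+(s^2-1)s_2)}.$$ Moreover $\mathbb{II}(\xi_{*0},\bar\xi_{0*})=0$, so there is no contribution from $\langle\mathbb{II}(\xi_{*0},\bar\xi_{0*}),\mathbb{II}(\xi_{*0},\bar\xi_{0*})\rangle_{KM}$.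
   Context: For a $C^4$ cost $\mathsf c$ on an open subset of a product $\mathcal M\times\bar{\mathcal M}$ of manifolds of equal dimension, the Kim-McCann pairing is $\langle(\omega_1,\bar\omega_1),(\omega_2,\bar\omega_2)\rangle_{KM}=-\frac12(D_{\omega_1}\bar D_{\bar\omega_2}\mathsf c+\bar D_{\bar\omega_1}D_{\omega_2}\mathsf c)$, where $D_\omega,\bar D_{\bar\omega}$ are directional derivatives in the first and second variable. When nondegenerate it is a semi-Riemannian metric. In local coordinates $x^i$, $\bar x^j$, with unbarred (barred) subscripts denoting partial derivatives in $x$ ($\bar x$) and $(\mathsf c^{a\bar f})$ the inverse of $(\mathsf c_{a\bar f})$ (i.e. $\sum_f\mathsf c^{a\bar f}\mathsf c_{b\bar f}=\delta^a_b$), the cross-curvature (MTW tensor) is $$\mathrm{cross}(\mathring\omega)=\frac12\sum_{i,l,j,k}\omega^i\omega^l\bar\omega^{j}\bar\omega^{k}\Big(\sum_{a,f}\mathsf c_{il\bar f}\,\mathsf c^{a\bar f}\,\mathsf c_{a\bar j\bar k}-\mathsf c_{il\bar j\bar k}\Big),\qquad\mathring\omega=(\omega,\bar\omega).$$ $\mathrm{cross}_{\mathbb S^n_{\mathfrak t,\epsilon}}$ is the cross-curvature of the cost restricted to $\mathcal N\subset\mathcal M\times\mathcal M$; $\mathrm{cross}_{\mathbb R^{n+1}}$ is that of the same formula $\mathsf u(x^{\mathfrak t}\bar x)$ considered near $(x,\bar x)$ on $\mathbb R^{n+1}\times\mathbb R^{n+1}$. The second fundamental form $\mathbb{II}$ of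 $\mathcal N$ in $\mathbb R^{n+1}\times\mathbb R^{n+1}$, both with the Kim-McCann metric, is $\mathbb{II}(\mathtt X,\mathtt Y)=(I-\Pi)\nabla_{\mathtt X}\mathtt Y$ for tangent vector fields $\mathtt X,\mathtt Y$ of $\mathcal N$, where $\nabla$ is the Levi-Civita connection of the ambient Kim-McCann metric and $\Pi$ is the metric-orthogonal projection onto $T\mathcal N$. Notation: $\xi_{*0}=(\xi,0)$ and $\bar\xi_{0*}=(0,\bar\xi)$. *)

(* Defs.v *)
From HB Require Import structures.
From mathcomp Require Import all_boot all_order all_algebra.
From mathcomp Require Import all_classical all_reals all_analysis.
Set Implicit Arguments.
Unset Strict Implicit.
Unset Printing Implicit Defensive.
Import Order.TTheory GRing.Theory Num.Theory.
Import numFieldNormedType.Exports.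
Local Open Scope classical_set_scope.
Local Open Scope ring_scope.

Section Calculus.
Context {R : realType}.

(* f is of class C^k on the open set U. In finite dimension, asking that every
   directional derivative 'D_v f be C^k amounts to asking it of the
   differential of f. *)
Fixpoint cont_diff {V W : normedModType R} (k : nat) (U : set V) (f : V -> W) :
    Prop :=
  match k with
  | 0 => forall x, U x -> {for x, continuous f}
  | k'.+1 => (forall x, U x -> differentiable f x) /\
             (forall v : V, cont_diff k' U ('D_v f))
  end.

Definition D1 {V V' : normedModType R} (v : V) (c : V -> V' -> R) : V -> V' -> R :=
  fun x xb => 'D_v (fun y => c y xb) x.

Definition D2 {V V' : normedModType R} (vb : V') (c : V -> V' -> R) :
    V -> V' -> R :=
  fun x xb => 'D_vb (c x) xb.

End Calculus.

Section SemiRiemannian.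
Context {R : realType} {E : normedModType R}.

(* nabla is the Levi-Civita connection of the semi-Riemannian metric g on the
   open set W of the vector space E. Vector fields are represented by functions
   E -> E of which only the restriction to W matters, and the Lie bracket
   [X, Y] is D_X Y - D_Y X. *)
Definition levi_civita (W : set E) (g : E -> E -> E -> R)
    (nabla : (E -> E) -> (E -> E) -> E -> E) : Prop :=
  let field (X : E -> E) := cont_diff 1 W X in
  let scalar (f : E -> R) := cont_diff 1 W f in
  [/\ forall f X X' Y, scalar f -> field X -> field X' -> field Y ->
        forall p, W p -> nabla (fun q => f q *: X q + X' q) Y p =
          f p *: nabla X Y p + nabla X' Y p,
      forall X Y Y', field X -> field Y -> field Y' ->
        forall p, W p -> nabla X (fun q => Y q + Y' q) p =
          nabla X Y p + nabla X Y' p,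
      forall f X Y, scalar f -> field X -> field Y ->
        forall p, W p -> nabla X (fun q => f q *: Y q) p =
          'D_(X p) f p *: Y p + f p *: nabla X Y p,
      forall X Y, field X -> field Y ->
        forall p, W p -> nabla X Y p - nabla Y X p =
          'D_(X p) Y p - 'D_(Y p) X p
    & forall X Y Z, field X -> field Y -> field Z ->
        forall p, W p -> 'D_(X p) (fun q => g q (Y q) (Z q)) p =
          g p (nabla X Y p) (Z p) + g p (Y p) (nabla X Z p)].

(* The g-orthogonal projection of z onto the subspace T; it is uniquely
   determined when g is nondegenerate on T. *)
Definition orth_proj (g : E -> E -> R) (T : set E) (z : E) : E :=
  xget 0 [set t | T t /\ forall w, T w -> g (z - t) w = 0].

(* T p is the tangent space at p of the submanifold. *)
Definition second_fundamental_form (g : E -> E -> E -> R)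
    (nabla : (E -> E) -> (E -> E) -> E -> E) (T : E -> set E)
    (X Y : E -> E) (p : E) : E :=
  nabla X Y p - orth_proj (g p) (T p) (nabla X Y p).

(* C^1 vector fields on the ambient open set W which are tangent to the
   submanifold N at the points of N. *)
Definition tangent_field (W N : set E) (T : E -> set E) (X : E -> E) : Prop :=
  cont_diff 1 W X /\ forall q, N q -> T q (X q).

End SemiRiemannian.

Section KimMcCann.
Context {R : realType}.

Definition KM {V V' : normedModType R} (c : V -> V' -> R)
    (p : V * V') (w1 w2 : V * V') : R :=
  - 2^-1 * (D1 w1.1 (D2 w2.2 c) p.1 p.2 + D2 w1.2 (D1 w2.1 c) p.1 p.2).

Context {n : nat}.
Implicit Types (c : 'rV[R]_n -> 'rV[R]_n -> R) (x xb : 'rV[R]_n).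

Definition e_ (i : 'I_n) : 'rV[R]_n := delta_mx 0 i.

Definition mixed_hessian c x xb : 'M[R]_n :=
  \matrix_(a, f) D1 (e_ a) (D2 (e_ f) c) x xb.

(* The matrix c^{a fb}, that is sum_f c^{a fb} c_{b fb} = delta^a_b: this is
   the transpose of the inverse of the matrix (c_{a fb}). *)
Definition mixed_inverse c x xb : 'M[R]_n := (invmx (mixed_hessian c x xb))^T.

Definition cross c x xb (w wb : 'rV[R]_n) : R :=
  2^-1 * \sum_(i < n) \sum_(l < n) \sum_(j < n) \sum_(k < n)
    w 0 i * w 0 l * wb 0 j * wb 0 k *
    ((\sum_(a < n) \sum_(f < n)
        D1 (e_ i) (D1 (e_ l) (D2 (e_ f) c)) x xb *
        mixed_inverse c x xb a f *
        D1 (e_ a) (D2 (e_ j) (D2 (e_ k) c)) x xb)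
     - D1 (e_ i) (D1 (e_ l) (D2 (e_ j) (D2 (e_ k) c))) x xb).

End KimMcCann.

Section Sphere.
Context {R : realType} {m : nat}.

Definition tdot (A : 'M[R]_m) (x y : 'rV[R]_m) : R := (x *m A *m y^T) 0 0.

Definition tsphere (A : 'M[R]_m) (eps : R) : set 'rV[R]_m :=
  [set x | tdot A x x = eps].

(* Tangent space at x of the level set of y |-> tdot A y y through x, as the
   kernel of the differential. *)
Definition tsphere_tangent (A : 'M[R]_m) (x : 'rV[R]_m) : set 'rV[R]_m :=
  [set v | 'D_v (fun y => tdot A y y) x = 0].

Definition tsphere2_tangent (A : 'M[R]_m) (p : 'rV[R]_m * 'rV[R]_m) :
    set ('rV[R]_m * 'rV[R]_m) :=
  tsphere_tangent A p.1 `*` tsphere_tangent A p.2.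

(* The inverse phi of a smooth chart of the n-dimensional submanifold M: a
   smooth immersion of an open set U, which is a homeomorphism onto an open
   subset of M. *)
Definition local_coordinates {n : nat} (M : set 'rV[R]_m) (U : set 'rV[R]_n)
    (phi : 'rV[R]_n -> 'rV[R]_m) : Prop :=
  [/\ open U,
      forall k, cont_diff k U phi,
      forall y, U y -> forall v, 'D_v phi y = 0 -> v = 0,
      set_inj U phi
    & forall U', open U' -> U' `<=` U ->
        exists O, open O /\ phi @` U' = O `&` M].

End Sphere.

(* Main.v *)
Require Import Defs.
From HB Require Import structures.
From mathcomp Require Import all_boot all_order all_algebra.
From mathcomp Require Import all_classical all_reals all_analysis.
From mathcomp Require Import ring lra.
Set Implicit Arguments.
Unset Strict Implicit.
Unset Printing Implicit Defensive.
Import Order.TTheory GRing.Theory Num.Theory.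
Import numFieldNormedType.Exports.
Local Open Scope classical_set_scope.
Local Open Scope ring_scope.

(* Write J(a, b) for the mixed second derivative D_a \bar D_b c at (x, xb), so
   that the Kim-McCann metric is -(J(a, b') + J(a', b)) / 2. Koszul's formula
   shows that nabla_X Y - D_X Y has first component G with J(G, f) equal to the
   third derivative of c in (X_1, Y_1; f). The normal space of N is spanned by
   (nu, 0) and (0, nub), where J(nu, f) = <xb, f> and J(f, nub) = <f, x>; hence
   the normal part of a vector (z, zb) is read off <z, x> and <zb, xb>, and for
   tangent fields the latter come from <D_X Y, x> = - <X, Y>.
   In coordinates phi, psi of the two spheres, the chain rule gives
   2 cross = P h^-1 Q - c_{1122}, where h is J restricted to the tangent spaces,
   P = J(al, .), Q = J(., be), al = G + phi'' and be = Gb + psi''. Removing the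
   normal component of al gives
   P h^-1 Q = J(al, be) - <al, x> <xb, be> / <nu, x>, and the last term is
   -2 times the contribution of the second fundamental form. *)

(** * Directional derivatives and the bilinear form [tdot] *)

Section DirectionalCalculus.
Context {R : realType}.

(** Differentiability travels with the value of the derivative: the product and chain rules need it,
    and ['D_v f z] alone does not provide it. *)
Definition has_deriv {V W : normedModType R} (f : V -> W) (z v : V) (d : W) :
    Prop :=
  differentiable f z /\ 'D_v f z = d.

Section Rules.
Context {V : normedModType R}.
Implicit Types (z v : V).

Lemma has_deriv_diff {W : normedModType R} (f : V -> W) z v :
  differentiable f z -> has_deriv f z v ('D_v f z).
Proof. by []. Qed.

Lemma has_deriv_cst {W : normedModType R} (k : W) z v :
  has_deriv (fun=> k) z v 0.
Proof. by split; [exact: differentiable_cst | exact: derive_cst]. Qed.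

Lemma has_deriv_id z v : has_deriv (fun y => y) z v v.
Proof. by split; [exact: ex_diff | exact: derive_id]. Qed.

Lemma has_derivD {W : normedModType R} (f g : V -> W) z v df dg :
  has_deriv f z v df -> has_deriv g z v dg ->
  has_deriv (fun y => f y + g y) z v (df + dg).
Proof.
move=> [f1 <-] [g1 <-]; split; first exact: differentiableD.
by rewrite -deriveD //; exact: diff_derivable.
Qed.

Lemma has_deriv_sum {W : normedModType R} k (f : 'I_k -> V -> W) z v df :
  (forall i, has_deriv (f i) z v (df i)) ->
  has_deriv (fun y => \sum_(i < k) f i y) z v (\sum_(i < k) df i).
Proof.
elim: k f df => [|k IH] f df h.
  rewrite (_ : (fun y => _) = fun=> 0); last by apply/funext => y; rewrite big_ord0.
  by rewrite big_ord0; exact: has_deriv_cst.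
rewrite (_ : (fun y => _) =
    fun y => (\sum_(i < k) f (widen_ord (leqnSn k) i) y) + f ord_max y).
  by rewrite big_ord_recr; apply: has_derivD => //; apply: IH => i; exact: h.
by apply/funext => y; rewrite big_ord_recr.
Qed.

Lemma has_derivM (f g : V -> R) z v df dg :
  has_deriv f z v df -> has_deriv g z v dg ->
  has_deriv (fun y => f y * g y) z v (df * g z + f z * dg).
Proof.
move=> [f1 <-] [g1 <-]; split; first exact: differentiableM.
rewrite deriveM /=; [|exact: diff_derivable..].
by rewrite addrC mulrC.
Qed.

Lemma has_deriv_eq {W : normedModType R} (f : V -> W) z v d d' :
  has_deriv f z v d -> d = d' -> has_deriv f z v d'.
Proof. by move=> h <-. Qed.

Lemma has_deriv_comp {V' W : normedModType R} (f : V -> V') (g : V' -> W) z v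
    df dg :
  has_deriv f z v df -> has_deriv g (f z) df dg ->
  has_deriv (fun y => g (f y)) z v dg.
Proof.
move=> [f1 <-] [g1 <-]; split; first exact: (differentiable_comp f1 g1).
rewrite !deriveE //; last exact: (differentiable_comp f1 g1).
by rewrite (diff_comp f1 g1).
Qed.

Lemma has_deriv_comp1 (f : V -> R) (g : R -> R) z v df dg :
  has_deriv f z v df -> has_deriv g (f z) 1 dg ->
  has_deriv (fun y => g (f y)) z v (dg * df).
Proof.
move=> hf [hg <-]; apply: has_deriv_comp hf _; split=> //.
by rewrite deriveE // diff1E //= mulrC derive1E.
Qed.

Lemma has_deriv_coord m (f : V -> 'rV[R]_m) z v df i :
  has_deriv f z v df -> has_deriv (fun y => f y 0 i) z v (df 0 i).
Proof.
move=> [f1 <-]; split.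
  by apply: (@differentiable_comp _ _ _ _ f (fun N : 'rV_m => N 0 i)) => //;
    exact: differentiable_coord.
by rewrite derive_mx ?mxE //; exact: diff_derivable.
Qed.

End Rules.

Lemma has_deriv_fst {V W W' : normedModType R} (f : V -> W * W') (z v : V) d :
  has_deriv f z v d -> has_deriv (fun y => (f y).1) z v d.1.
Proof.
move=> h; apply: (has_deriv_comp (g := fst) h).
pose L : {linear (W * W')%type -> W} := fst.
have c : continuous L by move=> p; exact: cvg_fst.
have dL : differentiable L (f z) by apply: linear_differentiable.
by split=> //; rewrite deriveE // (diff_lin _ c).
Qed.

Lemma has_deriv_snd {V W W' : normedModType R} (f : V -> W * W') (z v : V) d :
  has_deriv f z v d -> has_deriv (fun y => (f y).2) z v d.2.
Proof.
move=> h; apply: (has_deriv_comp (g := snd) h).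
pose L : {linear (W * W')%type -> W'} := snd.
have c : continuous L by move=> p; exact: cvg_snd.
have dL : differentiable L (f z) by apply: linear_differentiable.
by split=> //; rewrite deriveE // (diff_lin _ c).
Qed.

Lemma has_deriv_pair {V W W' : normedModType R} (f : V -> W) (g : V -> W')
    (z v : V) d d' :
  has_deriv f z v d -> has_deriv g z v d' ->
  has_deriv (fun y => (f y, g y)) z v (d, d').
Proof.
move=> [f1 <-] [g1 <-]; split; first exact: differentiable_pair.
by rewrite !deriveE // ?diff_pair //; exact: differentiable_pair.
Qed.

Lemma tdotDl m (A : 'M[R]_m) x y z : tdot A (x + y) z = tdot A x z + tdot A y z.
Proof. by rewrite /tdot !mulmxDl mxE. Qed.

Lemma tdotDr m (A : 'M[R]_m) x y z : tdot A x (y + z) = tdot A x y + tdot A x z.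
Proof. by rewrite /tdot linearD mulmxDr mxE. Qed.

Lemma tdotZl m (A : 'M[R]_m) k x z : tdot A (k *: x) z = k * tdot A x z.
Proof. by rewrite /tdot -!scalemxAl mxE. Qed.

Lemma tdotZr m (A : 'M[R]_m) k x z : tdot A x (k *: z) = k * tdot A x z.
Proof. by rewrite /tdot linearZ -scalemxAr mxE. Qed.

Lemma tdot0l m (A : 'M[R]_m) z : tdot A 0 z = 0.
Proof. by rewrite -(scale0r 0) tdotZl mul0r. Qed.

Lemma tdot0r m (A : 'M[R]_m) z : tdot A z 0 = 0.
Proof. by rewrite -(scale0r 0) tdotZr mul0r. Qed.

Lemma tdotBl m (A : 'M[R]_m) x y z : tdot A (x - y) z = tdot A x z - tdot A y z.
Proof. by rewrite tdotDl -scaleN1r tdotZl mulN1r. Qed.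

Lemma tdotBr m (A : 'M[R]_m) x y z : tdot A x (y - z) = tdot A x y - tdot A x z.
Proof. by rewrite tdotDr -scaleN1r tdotZr mulN1r. Qed.

Lemma tdotE m (A : 'M[R]_m) x y :
  tdot A x y = \sum_(j < m) \sum_(i < m) x 0 i * A i j * y 0 j.
Proof.
rewrite /tdot mxE; apply: eq_bigr => j _.
by rewrite !mxE big_distrl.
Qed.

Lemma tdotC m (A : 'M[R]_m) x y : A^T = A -> tdot A x y = tdot A y x.
Proof.
move=> sA; rewrite /tdot; transitivity ((y *m A *m x^T)^T 0 0).
  by rewrite !trmx_mul trmxK sA mulmxA.
by rewrite mxE.
Qed.

Lemma has_deriv_tdot {V : normedModType R} m (A : 'M[R]_m)
    (f g : V -> 'rV[R]_m) (z v : V) df dg :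
  has_deriv f z v df -> has_deriv g z v dg ->
  has_deriv (fun y => tdot A (f y) (g y)) z v
    (tdot A df (g z) + tdot A (f z) dg).
Proof.
move=> hf hg; under [X in has_deriv X]eq_fun do rewrite tdotE.
apply: has_deriv_eq.
  apply: has_deriv_sum => j; apply: has_deriv_sum => i.
  apply: has_derivM (has_deriv_coord j hg).
  by apply: has_derivM (has_deriv_coord i hf) _; exact: has_deriv_cst.
rewrite !tdotE -big_split; apply: eq_bigr => j _; rewrite -big_split.
by apply: eq_bigr => i _ /=; ring.
Qed.

End DirectionalCalculus.

(** * Derivatives of [u] in terms of those of its inverse [s] *)

Section DerivativeSequences.
Context {R : realType}.

(** Each differentiation becomes a shift of the index. The last member [f k] occurs only as a value
    of a derivative. *)
Definition deriv_seq (k : nat) (I : set R) (f : nat -> R -> R) : Prop :=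
  forall i t, (i < k)%N -> I t -> has_deriv (f i) t 1 (f i.+1 t).

Lemma cont_diff_deriv_seq (k : nat) (U : set R) (f : R -> R) :
  cont_diff k U f -> deriv_seq k U (fun i => derive1n i f).
Proof.
elim: k f => // k IH f [df dDf] [|i] t ik Ut.
  by split; [exact: df | rewrite derive1nS derive1E].
rewrite !(derive1Sn f); apply: IH => //.
suff -> : derive1 f = 'D_1 f by exact: dDf.
by apply/funext => y; rewrite derive1E.
Qed.

Lemma has_deriv_unique {V W : normedModType R} (f g : V -> W) z v d d' :
  (\near z, f z = g z) -> has_deriv f z v d -> has_deriv g z v d' -> d = d'.
Proof. by move=> fg [_ <-] [_ <-]; exact: near_eq_derive. Qed.

(** The relation [s (u t) = t] holds on an open set, so it can be differentiated four times. Each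
    new relation is linear in the newest derivative of [u], with coefficient [s_ 1], and is solved
    for it; the first relation shows that this coefficient is non-zero. *)
Lemma inverse_derivatives (I J : set R) (u s : nat -> R -> R) (t : R) :
  open I -> deriv_seq 4 I u -> deriv_seq 4 J s ->
  (forall t, I t -> J (u 0%N t)) ->
  (forall t, I t -> s 0%N (u 0%N t) = t) -> I t ->
  let s_ k := s k (u 0%N t) in
  [/\ s_ 1%N != 0,
      u 1%N t = (s_ 1%N)^-1,
      u 2%N t = - s_ 2%N / s_ 1%N ^+ 3,
      u 3%N t = (3 * s_ 2%N ^+ 2 - s_ 1%N * s_ 3%N) / s_ 1%N ^+ 5
    & u 4%N t = (- s_ 4%N * s_ 1%N ^+ 2 + 10 * s_ 1%N * s_ 2%N * s_ 3%N
                 - 15 * s_ 2%N ^+ 3) / s_ 1%N ^+ 7].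
Proof.
move=> oI hu hs IJ su It s_.
have {}hs k y : (k < 4)%N -> I y ->
    has_deriv (fun y => s k (u 0%N y)) y 1 (s k.+1 (u 0%N y) * u 1%N y).
  by move=> k4 Iy; apply: has_deriv_comp1; [exact: hu|apply: hs => //; exact: IJ].
have D_ (f g : R -> R) y d d' : (forall y, I y -> f y = g y) -> I y ->
    has_deriv f y (1 : R) d -> has_deriv g y 1 d' -> d = d'.
  move=> fg Iy; apply: has_deriv_unique.
  by apply: filterS (open_nbhs_nbhs (conj oI Iy)) => ?; exact: fg.
have e1 y : I y -> s 1%N (u 0%N y) * u 1%N y = 1.
  by move=> Iy; exact: D_ su Iy (hs 0%N y isT Iy) (has_deriv_id _ _).
have e2 y : I y -> s 2%N (u 0%N y) * u 1%N y ^+ 2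
    + s 1%N (u 0%N y) * u 2%N y = 0.
  move=> Iy.
  apply: etrans (D_ _ _ _ _ _ e1 Iy _ (has_deriv_cst _ _ _)); last first.
    by apply: has_derivM; [exact: hs | exact: hu].
  by rewrite /=; ring.
have e3 y : I y -> s 3%N (u 0%N y) * u 1%N y ^+ 3
    + 3 * s 2%N (u 0%N y) * u 1%N y * u 2%N y
    + s 1%N (u 0%N y) * u 3%N y = 0.
  move=> Iy.
  apply: etrans (D_ _ _ _ _ _ e2 Iy _ (has_deriv_cst _ _ _)); last first.
    apply: has_derivD; last by apply: has_derivM; [exact: hs | exact: hu].
    by apply: has_derivM; [exact: hs | apply: has_derivM; exact: hu].
  by rewrite /=; ring.
have e4 y : I y -> s 4%N (u 0%N y) * u 1%N y ^+ 4
    + 6 * s 3%N (u 0%N y) * u 1%N y ^+ 2 * u 2%N y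
    + 3 * s 2%N (u 0%N y) * u 2%N y ^+ 2
    + 4 * s 2%N (u 0%N y) * u 1%N y * u 3%N y
    + s 1%N (u 0%N y) * u 4%N y = 0.
  move=> Iy.
  apply: etrans (D_ _ _ _ _ _ e3 Iy _ (has_deriv_cst _ _ _)); last first.
    apply: has_derivD; last by apply: has_derivM; [exact: hs | exact: hu].
    apply: has_derivD.
      apply: has_derivM; [exact: hs|].
      by apply: has_derivM; [exact: hu|apply: has_derivM; exact: hu].
    apply: has_derivM; [|exact: hu].
    apply: has_derivM; [|exact: hu].
    by apply: has_derivM; [exact: has_deriv_cst|exact: hs].
  by rewrite /=; ring.
move: (e1 t It) (e2 t It) (e3 t It) (e4 t It); rewrite /s_.
move: (s 1%N _) (s 2%N _) (s 3%N _) (s 4%N _) (u 1%N t) (u 2%N t) (u 3%N t)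
  (u 4%N t).
move=> s1 s2 s3 s4 u1 u2 u3 u4 r1 r2 r3 r4.
have s10 : s1 != 0.
  by apply/eqP => s10; move/eqP: r1; rewrite s10 mul0r eq_sym oner_eq0.
have E1 : u1 = s1^-1 by apply: (mulfI s10); rewrite r1 mulfV.
have E2 : u2 = - s2 / s1 ^+ 3.
  (* After multiplication by [s1] the unknown is the last summand of the relation, and [addKr] moves
     the other summands across. *)
  apply: (mulfI s10); rewrite -[LHS](addKr (s2 * u1 ^+ 2)) r2 E1.
  by field.
have E3 : u3 = (3 * s2 ^+ 2 - s1 * s3) / s1 ^+ 5.
  apply: (mulfI s10).
  rewrite -[LHS](addKr (s3 * u1 ^+ 3 + 3 * s2 * u1 * u2)) r3 E1 E2.
  by field.
split=> //; apply: (mulfI s10).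
rewrite -[LHS](addKr (s4 * u1 ^+ 4 + 6 * s3 * u1 ^+ 2 * u2 + 3 * s2 * u2 ^+ 2
  + 4 * s2 * u1 * u3)) r4 E1 E2 E3.
by field.
Qed.

End DerivativeSequences.

(** The derivative is built as an unknown by following the syntax of the function; [base] treats the
    leaves. *)
Ltac has_deriv_rules base :=
  lazymatch goal with
  | |- has_deriv (fun y => _ + _) _ _ _ =>
      refine (has_derivD _ _); has_deriv_rules base
  | |- has_deriv (fun y => _ * _) _ _ _ =>
      refine (has_derivM _ _); has_deriv_rules base
  | |- has_deriv (fun y => tdot _ _ _) _ _ _ =>
      refine (has_deriv_tdot _ _ _); has_deriv_rules base
  | |- _ => first [exact (has_deriv_cst _ _ _) | exact (has_deriv_id _ _) | base tt]
  end.

(** Pairings become independent variables, those with a zero entry being replaced by 0, which leaves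
    polynomial identities for [ring]. *)
Ltac generalize_tdots :=
  repeat match goal with
  | |- context [tdot ?A (@Algebra.zero ?Z) ?y] =>
      generalize (tdot0l A y : tdot A (@Algebra.zero Z) y = 0);
      generalize (tdot A (@Algebra.zero Z) y); intros ? ->
  | |- context [tdot ?A ?x (@Algebra.zero ?Z)] =>
      generalize (tdot0r A x : tdot A x (@Algebra.zero Z) = 0);
      generalize (tdot A x (@Algebra.zero Z)); intros ? ->
  | |- context [tdot ?A ?x ?y] => generalize (tdot A x y); intro
  end.

(** * Partial derivatives of a cost pulled back by two parametrizations *)

Section PulledBackCost.
Context {R : realType} {q : nat} (A : 'M[R]_q) (u : nat -> R -> R).
Implicit Types (x xb : 'rV[R]_q).

Local Notation T := (tdot A).

(** This is the form J, the mixed second derivative of [u 0 (T x xb)]. The jets are written for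
    arbitrary vectors, so that the same formulas serve the ambient space and all
    parametrizations. *)
Definition jet12 x xb a f : R :=
  u 2%N (T x xb) * T a xb * T x f + u 1%N (T x xb) * (T a f).

(** The argument [il], like [jk] in the next jets, stands for a second derivative of the
    parametrization; the value 0 gives the derivatives of the ambient cost. *)
Definition jet112 x xb i l il f : R :=
  u 3%N (T x xb) * T i xb * T l xb * (T x f)
  + u 2%N (T x xb) *
      (T il xb * T x f + T l xb * T i f + T i xb * T l f)
  + u 1%N (T x xb) * (T il f).

Definition jet122 x xb a j k jk : R :=
  u 3%N (T x xb) * T a xb * T x j * (T x k)
  + u 2%N (T x xb) *
      (T a j * T x k + T x j * T a k + T a xb * T x jk)
  + u 1%N (T x xb) * (T a jk).

Definition jet1122 x xb i l il j k jk : R :=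
  u 4%N (T x xb) * T i xb * T l xb * T x j * (T x k)
  + u 3%N (T x xb) *
      (T il xb * T x j * T x k + T l xb * T i j * (T x k)
       + T l xb * T x j * T i k + T i xb * T l j * (T x k)
       + T i xb * T x j * T l k + T i xb * T l xb * T x jk)
  + u 2%N (T x xb) *
      (T il j * T x k + T l j * T i k + T i j * (T l k)
       + T x j * T il k + T il xb * T x jk + T l xb * (T i jk)
       + T i xb * T l jk)
  + u 1%N (T x xb) * (T il jk).

Context {V V' : normedModType R} (I : set R) (U : set V) (Ub : set V')
  (phi : V -> 'rV[R]_q) (psi : V' -> 'rV[R]_q).
Hypotheses (oI : open I) (oU : open U) (oUb : open Ub)
  (hu : deriv_seq 4 I u) (hphi : cont_diff 2 U phi) (hpsi : cont_diff 2 Ub psi).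

Let C (z : V) (zb : V') : R := u 0%N (T (phi z) (psi zb)).

Definition cost_domain (z : V) (zb : V') : Prop :=
  [/\ U z, Ub zb & I (T (phi z) (psi zb))].
Local Notation Om := cost_domain.

Let phi1 z v : U z -> has_deriv phi z v ('D_v phi z).
Proof. by move=> Uz; apply: has_deriv_diff; case: hphi => + _; exact. Qed.

Let phi2 z l v : U z -> has_deriv ('D_l phi) z v ('D_v ('D_l phi) z).
Proof.
by move=> Uz; apply: has_deriv_diff; case: hphi => _ /(_ l) [+ _]; exact.
Qed.

Let psi1 z v : Ub z -> has_deriv psi z v ('D_v psi z).
Proof. by move=> Uz; apply: has_deriv_diff; case: hpsi => + _; exact. Qed.

Let psi2 z l v : Ub z -> has_deriv ('D_l psi) z v ('D_v ('D_l psi) z).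
Proof.
by move=> Uz; apply: has_deriv_diff; case: hpsi => _ /(_ l) [+ _]; exact.
Qed.

Lemma near_preimage_open {W W' : normedModType R} (f : W -> W') (B : set W')
    (z v : W) d : open B -> has_deriv f z v d -> B (f z) -> \near z, B (f z).
Proof.
move=> oB [df _] Bz; have := differentiable_continuous df.
by apply; exact: open_nbhs_nbhs.
Qed.

Lemma near_fst_domain z zb : Om z zb -> \near z, Om z zb.
Proof.
move=> [Uz Ubz Iz].
have h := has_deriv_tdot A (phi1 0 Uz) (has_deriv_cst (psi zb) z 0).
apply: filterS2 (open_nbhs_nbhs (conj oU Uz)) (near_preimage_open oI h Iz).
by move=> y Uy Iy; split.
Qed.

Lemma near_snd_domain z zb : Om z zb -> \near zb, Om z zb.
Proof.
move=> [Uz Ubz Iz].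
have h := has_deriv_tdot A (has_deriv_cst (phi z) zb 0) (psi1 0 Ubz).
apply: filterS2 (open_nbhs_nbhs (conj oUb Ubz)) (near_preimage_open oI h Iz).
by move=> y Uy Iy; split.
Qed.

(** A formula for [F] valid on the whole domain also holds near the point, so it may be
    differentiated again; iterated derivatives are computed one order at a time in this way. *)
Lemma D1_has_deriv (F F' : V -> V' -> R) z zb v d :
  (forall z zb, Om z zb -> F z zb = F' z zb) -> Om z zb ->
  has_deriv (fun z => F' z zb) z v d -> D1 v F z zb = d.
Proof.
move=> FF' Oz [_ <-]; apply: near_eq_derive.
by apply: filterS (near_fst_domain Oz) => y; exact: FF'.
Qed.

Lemma D2_has_deriv (F F' : V -> V' -> R) z zb v d :
  (forall z zb, Om z zb -> F z zb = F' z zb) -> Om z zb ->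
  has_deriv (F' z) zb v d -> D2 v F z zb = d.
Proof.
move=> FF' Oz [_ <-]; apply: near_eq_derive.
by apply: filterS (near_snd_domain Oz) => y; exact: FF'.
Qed.

Let u_fst k z zb v : (k < 4)%N -> Om z zb ->
  has_deriv (fun z => u k (T (phi z) (psi zb))) z v
    (u k.+1 (T (phi z) (psi zb)) * (T ('D_v phi z) (psi zb))).
Proof.
move=> k4 [Uz Ubz Iz]; apply: has_deriv_comp1; last exact: hu.
apply: has_deriv_eq.
  by apply: has_deriv_tdot; [exact: phi1|exact: has_deriv_cst].
by rewrite tdot0r addr0.
Qed.

Let u_snd k z zb v : (k < 4)%N -> Om z zb ->
  has_deriv (fun zb => u k (T (phi z) (psi zb))) zb v
    (u k.+1 (T (phi z) (psi zb)) * (T (phi z) ('D_v psi zb))).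
Proof.
move=> k4 [Uz Ubz Iz]; apply: has_deriv_comp1; last exact: hu.
apply: has_deriv_eq.
  by apply: has_deriv_tdot; [exact: has_deriv_cst|exact: psi1].
by rewrite tdot0l add0r.
Qed.

Ltac solve_base tt :=
  lazymatch goal with
  | |- has_deriv (fun y => u _ _) _ _ _ => first [exact: u_fst | exact: u_snd]
  | |- has_deriv (fun y => derive phi _ _) _ _ _ => exact: phi2
  | |- has_deriv (fun y => derive psi _ _) _ _ _ => exact: psi2
  | |- has_deriv phi _ _ _ => exact: phi1
  | |- has_deriv psi _ _ _ => exact: psi1
  end.
Ltac solve_deriv :=
  apply: has_deriv_eq; [has_deriv_rules solve_base
                       | cbn beta; generalize_tdots;
    repeat match goal with |- context [u ?k ?t] => generalize (u k t); intro end;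
    ring].

Lemma D2_cost z zb f : Om z zb ->
  D2 f C z zb = u 1%N (T (phi z) (psi zb)) * (T (phi z) ('D_f psi zb)).
Proof.
move=> Oz; apply: (D2_has_deriv (F' := C) _ Oz) => //.
exact: u_snd.
Qed.

Lemma D1_cost z zb a : Om z zb ->
  D1 a C z zb = u 1%N (T (phi z) (psi zb)) * (T ('D_a phi z) (psi zb)).
Proof.
move=> Oz; apply: (D1_has_deriv (F' := C) _ Oz) => //.
exact: u_fst.
Qed.

Lemma D1D2_cost z zb a f : Om z zb ->
  D1 a (D2 f C) z zb = jet12 (phi z) (psi zb) ('D_a phi z) ('D_f psi zb).
Proof.
move=> Oz; have [Uz Ubz _] := Oz.
apply: (D1_has_deriv (fun z zb => @D2_cost z zb f) Oz).
by rewrite /jet12; solve_deriv.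
Qed.

Lemma D2D1_cost z zb a f : Om z zb ->
  D2 f (D1 a C) z zb = jet12 (phi z) (psi zb) ('D_a phi z) ('D_f psi zb).
Proof.
move=> Oz; have [Uz Ubz _] := Oz.
apply: (D2_has_deriv (fun z zb => @D1_cost z zb a) Oz).
by rewrite /jet12; solve_deriv.
Qed.

Lemma D1D1D2_cost z zb i l f : Om z zb ->
  D1 i (D1 l (D2 f C)) z zb =
  jet112 (phi z) (psi zb) ('D_i phi z) ('D_l phi z) ('D_i ('D_l phi) z)
    ('D_f psi zb).
Proof.
move=> Oz; have [Uz Ubz _] := Oz.
apply: (D1_has_deriv (fun z zb => @D1D2_cost z zb l f) Oz).
by rewrite /jet12 /jet112; solve_deriv.
Qed.

Lemma D2D2_cost z zb j k : Om z zb ->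
  D2 j (D2 k C) z zb =
  u 2%N (T (phi z) (psi zb)) * (T (phi z) ('D_j psi zb)) * (T (phi z) ('D_k psi zb))
  + u 1%N (T (phi z) (psi zb)) * (T (phi z) ('D_j ('D_k psi) zb)).
Proof.
move=> Oz; have [Uz Ubz _] := Oz.
apply: (D2_has_deriv (fun z zb => @D2_cost z zb k) Oz).
by solve_deriv.
Qed.

Lemma D1D2D2_cost z zb a j k : Om z zb ->
  D1 a (D2 j (D2 k C)) z zb =
  jet122 (phi z) (psi zb) ('D_a phi z) ('D_j psi zb) ('D_k psi zb)
    ('D_j ('D_k psi) zb).
Proof.
move=> Oz; have [Uz Ubz _] := Oz.
apply: (D1_has_deriv (fun z zb => @D2D2_cost z zb j k) Oz).
by rewrite /jet122; solve_deriv.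
Qed.

Lemma D1D1D2D2_cost z zb i l j k : Om z zb ->
  D1 i (D1 l (D2 j (D2 k C))) z zb =
  jet1122 (phi z) (psi zb) ('D_i phi z) ('D_l phi z) ('D_i ('D_l phi) z)
    ('D_j psi zb) ('D_k psi zb) ('D_j ('D_k psi) zb).
Proof.
move=> Oz; have [Uz Ubz _] := Oz.
apply: (D1_has_deriv (fun z zb => @D1D2D2_cost z zb l j k) Oz).
by rewrite /jet122 /jet1122; solve_deriv.
Qed.

End PulledBackCost.

(** * The Levi-Civita connection of the ambient Kim-McCann metric *)

Section LeviCivita.
Context {R : realType} {q : nat} (A : 'M[R]_q) (u : nat -> R -> R) (I : set R).
Hypotheses (oI : open I) (hu : deriv_seq 4 I u).
Local Notation V := 'rV[R]_q.
Local Notation T := (tdot A).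
Local Notation c := (fun x xb : V => u 0%N (tdot A x xb)).
Local Notation W := [set p : V * V | I (tdot A p.1 p.2)].

Lemma cont_diff_id {V' : normedModType R} (U : set V') : cont_diff 2 U id.
Proof.
have D1id v : 'D_v (id : V' -> V') = cst v.
  by apply/funext => x; exact: derive_id.
split=> [x _|v]; first exact: ex_diff.
rewrite D1id; split=> [x _|w x _]; first exact: differentiable_cst.
rewrite (_ : 'D_w (cst v) = cst 0); last by apply/funext => y; exact: derive_cst.
exact: cvg_cst.
Qed.

Lemma domain_id (x xb : V) : I (T x xb) -> cost_domain A I setT setT id id x xb.
Proof. by split. Qed.

(** The ambient space is parametrized by the identity in both factors, and both orders of mixed
    differentiation give the same [jet12]. *)
Lemma KM_cost (p w1 w2 : V * V) : W p ->
  KM c p w1 w2 = - 2^-1 * (jet12 A u p.1 p.2 w1.1 w2.2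
                           + jet12 A u p.1 p.2 w2.1 w1.2).
Proof.
move=> Wp; have id2 := @cont_diff_id V setT.
rewrite /KM (D1D2_cost oI openT openT hu id2 id2 _ _ (domain_id Wp)).
by rewrite (D2D1_cost oI openT openT hu id2 id2 _ _ (domain_id Wp)) !derive_id.
Qed.

Lemma jet12Dl (x xb a b f : V) :
  jet12 A u x xb (a + b) f = jet12 A u x xb a f + jet12 A u x xb b f.
Proof. by rewrite /jet12 !tdotDl; ring. Qed.

Lemma jet12Dr (x xb a f g : V) :
  jet12 A u x xb a (f + g) = jet12 A u x xb a f + jet12 A u x xb a g.
Proof. by rewrite /jet12 !tdotDr; ring. Qed.

Lemma jet12Zl (x xb a f : V) k :
  jet12 A u x xb (k *: a) f = k * jet12 A u x xb a f.
Proof. by rewrite /jet12 !tdotZl; ring. Qed.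

Lemma jet12Zr (x xb a f : V) k :
  jet12 A u x xb a (k *: f) = k * jet12 A u x xb a f.
Proof. by rewrite /jet12 !tdotZr; ring. Qed.

Lemma jet12Bl (x xb a b f : V) :
  jet12 A u x xb (a - b) f = jet12 A u x xb a f - jet12 A u x xb b f.
Proof. by rewrite jet12Dl -scaleN1r jet12Zl mulN1r. Qed.

Lemma jet12_0l (x xb f : V) : jet12 A u x xb 0 f = 0.
Proof. by rewrite -(scale0r 0) jet12Zl mul0r. Qed.

Lemma jet12_0r (x xb a : V) : jet12 A u x xb a 0 = 0.
Proof. by rewrite -(scale0r 0) jet12Zr mul0r. Qed.

Lemma jet112C (x xb i l f : V) :
  jet112 A u x xb i l 0 f = jet112 A u x xb l i 0 f.
Proof. by rewrite /jet112; ring. Qed.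

Lemma jet122C (x xb a j k : V) :
  jet122 A u x xb a j k 0 = jet122 A u x xb a k j 0.
Proof. by rewrite /jet122; ring. Qed.

(** Moving the base point produces third derivatives of the cost; moving the two vectors produces
    [jet12] again. *)
Lemma has_deriv_jet12 {V' : normedModType R} (x xb a f : V' -> V) (p v : V')
    dx dxb da df : I (T (x p) (xb p)) ->
  has_deriv x p v dx -> has_deriv xb p v dxb ->
  has_deriv a p v da -> has_deriv f p v df ->
  has_deriv (fun r => jet12 A u (x r) (xb r) (a r) (f r)) p v
    (jet112 A u (x p) (xb p) dx (a p) 0 (f p)
     + jet122 A u (x p) (xb p) (a p) dxb (f p) 0
     + jet12 A u (x p) (xb p) da (f p) + jet12 A u (x p) (xb p) (a p) df).
Proof.
move=> Ip h1 h2 ha hf.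
have hu' k : (k < 4)%N -> has_deriv (fun r => u k (T (x r) (xb r))) p v
    (u k.+1 (T (x p) (xb p)) * (T dx (xb p) + T (x p) dxb)).
  move=> k4; apply: has_deriv_comp1; last exact: hu.
  exact: has_deriv_tdot.
have [hu1 hu2] := (hu' 1%N isT, hu' 2%N isT).
rewrite /jet12 /jet112 /jet122; apply: has_deriv_eq.
  has_deriv_rules ltac:(fun _ => eassumption).
cbn beta; generalize_tdots.
repeat match goal with |- context [u ?k ?t] => generalize (u k t); intro end.
ring.
Qed.

Variable nabla : (V * V -> V * V) -> (V * V -> V * V) -> V * V -> V * V.
Hypothesis nablaP : levi_civita W (KM c) nabla.

Lemma near_W (p : V * V) : W p -> \near p, W p.
Proof.
move=> Wp; have h1 := has_deriv_fst (has_deriv_id p 0).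
have h2 := has_deriv_snd (has_deriv_id p 0).
exact: near_preimage_open oI (has_deriv_tdot A h1 h2) Wp.
Qed.

Lemma derive_KM (X Y : V * V -> V * V) (p v : V * V) :
  cont_diff 1 W X -> cont_diff 1 W Y -> W p ->
  let x := p.1 in let xb := p.2 in
  let dX := 'D_v X p in let dY := 'D_v Y p in
  'D_v (fun r => KM c r (X r) (Y r)) p = - 2^-1 *
    ((jet112 A u x xb v.1 (X p).1 0 (Y p).2 + jet122 A u x xb (X p).1 v.2 (Y p).2 0
      + jet12 A u x xb dX.1 (Y p).2 + jet12 A u x xb (X p).1 dY.2)
     + (jet112 A u x xb v.1 (Y p).1 0 (X p).2 + jet122 A u x xb (Y p).1 v.2 (X p).2 0
      + jet12 A u x xb dY.1 (X p).2 + jet12 A u x xb (Y p).1 dX.2)).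
Proof.
move=> [CX _] [CY _] Wp x xb dX dY.
have hX := has_deriv_diff v (CX p Wp); have hY := has_deriv_diff v (CY p Wp).
have h1 := has_deriv_fst (has_deriv_id p v).
have h2 := has_deriv_snd (has_deriv_id p v).
have h3 := has_deriv_jet12 Wp h1 h2 (has_deriv_fst hX) (has_deriv_snd hY).
have h4 := has_deriv_jet12 Wp h1 h2 (has_deriv_fst hY) (has_deriv_snd hX).
have [_ E] := has_derivM (has_deriv_cst (- 2^-1 : R) p v) (has_derivD h3 h4).
rewrite mul0r add0r in E; rewrite -E; apply: near_eq_derive.
by apply: filterS (near_W Wp) => r Wr; rewrite KM_cost.
Qed.

(* Koszul's formula: both g(nabla_X Y - D_X Y, (0, f)) and
   g(nabla_X Y - D_X Y, (a, 0)) are third derivatives of the cost, the mixed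
   ones cancel. *)
Lemma christoffel_cost (X Y : V * V -> V * V) (p : V * V) :
  cont_diff 1 W X -> cont_diff 1 W Y -> W p ->
  let G := nabla X Y p - 'D_(X p) Y p in
  (forall f, jet12 A u p.1 p.2 G.1 f =
             jet112 A u p.1 p.2 (X p).1 (Y p).1 0 f) /\
  (forall a, jet12 A u p.1 p.2 a G.2 =
             jet122 A u p.1 p.2 a (X p).2 (Y p).2 0).
Proof.
move=> CX CY Wp G.
have key (z : V * V) :
    jet12 A u p.1 p.2 G.1 z.2 + jet12 A u p.1 p.2 z.1 G.2 =
    jet112 A u p.1 p.2 (X p).1 (Y p).1 0 z.2 +
    jet122 A u p.1 p.2 z.1 (X p).2 (Y p).2 0.
  (* The constant extension of [z] has zero derivative, so only derivatives of [X], of [Y] and of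
     the metric remain. *)
  pose Z : V * V -> V * V := cst z.
  have CZ : cont_diff 1 W Z.
    split=> [r _|v r _]; first exact: differentiable_cst.
    rewrite (_ : 'D_v Z = cst 0); last by apply/funext => y; exact: derive_cst.
    exact: cvg_cst.
  have [_ _ _ tor met] := nablaP.
  have DZ v : 'D_v Z p = 0 by exact: derive_cst.
  have E1 := met X Y Z CX CY CZ p Wp.
  rewrite (derive_KM _ CY CZ Wp) !(KM_cost _ _ Wp) DZ in E1.
  have E2 := met Y X Z CY CX CZ p Wp.
  rewrite (derive_KM _ CX CZ Wp) !(KM_cost _ _ Wp) DZ in E2.
  have E3 := met Z X Y CZ CX CY p Wp.
  rewrite (derive_KM _ CX CY Wp) !(KM_cost _ _ Wp) in E3.
  have T1 : nabla X Y p = G + 'D_(X p) Y p by rewrite subrK.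
  have eqD (a b d : V * V) : a - b = d -> a = b + d.
    by move=> <-; rewrite addrC subrK.
  (* Torsion-freeness trades nabla_Y X, nabla_X Z and nabla_Y Z for nabla_X Y, nabla_Z X and nabla_Z
     Y. *)
  have T2 := tor Y X CY CX p Wp; rewrite {}T1 in E1 T2.
  have {}T2 := eqD _ _ _ T2; rewrite {}T2 in E2.
  have T3 := eqD _ _ _ (tor X Z CX CZ p Wp).
  rewrite DZ in T3; rewrite {}T3 in E1.
  have T4 := eqD _ _ _ (tor Y Z CY CZ p Wp).
  rewrite DZ in T4; rewrite {}T4 in E2.
  rewrite /Z /cst in E1 E2 E3.
  move: (nabla (cst z) X p) (nabla (cst z) Y p) E1 E2 E3 => c1 c2.
  move: ('D_(X p) Y p) ('D_(Y p) X p) ('D_z X p) ('D_z Y p).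
  move: G (X p) (Y p) => [G1 G2] [X1 X2] [Y1 Y2].
  move=> [a1 a2] [b1 b2] [d1 d2] [e1 e2]; case: p z c1 c2 {Wp DZ Z CZ} => x xb.
  move=> [z1 z2] [f1 f2] [g1 g2] /=.
  rewrite (jet112C x xb Y1 X1) (jet112C x xb z1 X1) (jet112C x xb z1 Y1).
  rewrite (jet122C x xb Y1 X2) (jet122C x xb X1 Y2) (jet122C x xb z1 Y2).
  move: (jet12Dl x xb) (jet12Dr x xb) (jet12Zl x xb) (jet12Zr x xb).
  move: (jet12 A u x xb) (jet112 A u x xb) (jet122 A u x xb).
  move=> J J112 J122 JDl JDr JZl JZr.
  have J0l f : J 0 f = 0 by rewrite -(scale0r 0) JZl mul0r.
  have J0r a : J a 0 = 0 by rewrite -(scale0r 0) JZr mul0r.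
  have JNl a f : J (- a) f = - J a f by rewrite -scaleN1r JZl mulN1r.
  have JNr a f : J a (- f) = - J a f by rewrite -scaleN1r JZr mulN1r.
  rewrite !(JDl, JDr, JNl, JNr, J0l, J0r) => E1 E2 E3.
  (* In [E1 + E2 - E3] the unknowns nabla_Z X and nabla_Z Y cancel. *)
  lra.
split=> [f|a].
  have := key (0, f); rewrite /= jet12_0l addr0 => ->.
  by rewrite /jet122 !tdot0l; ring.
have := key (a, 0); rewrite /= jet12_0r add0r => ->.
by rewrite /jet112 !tdot0r; ring.
Qed.

End LeviCivita.

(** * Quadrics and the vector fields tangent to their product *)

Section TangentFields.
Context {R : realType} {q : nat} (A : 'M[R]_q) (eps : R).
Hypotheses (symA : A^T = A) (eps2 : eps ^+ 2 = 1).
Local Notation V := 'rV[R]_q.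
Local Notation T := (tdot A).
Local Notation M := (tsphere A eps).

Lemma has_derivZl {V' W : normedModType R} (k : V' -> R) (w : W) z v dk :
  has_deriv k z v dk -> has_deriv (fun y => k y *: w) z v (dk *: w).
Proof.
move=> [dfk <-]; have df := differentiableZl w dfk.
by split=> //; rewrite !deriveE // diffZl.
Qed.

Lemma tsphere_tangentE (x v : V) : tsphere_tangent A x v <-> T v x = 0.
Proof.
rewrite /tsphere_tangent /=.
have [_ ->] := has_deriv_tdot A (has_deriv_id x v) (has_deriv_id x v).
rewrite (tdotC v x symA) -mulr2n -mulr_natr; split=> [/eqP|->]; last by rewrite mul0r.
by rewrite mulf_eq0 pnatr_eq0 orbF => /eqP.
Qed.

(* The rational parametrization of the conic cut out of the quadric M by the
   plane spanned by x and v. *)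
Lemma tsphere_curve (x v : V) : M x -> T v x = 0 ->
  exists gam : R -> V, [/\ gam 0 = x, (\forall t \near (0 : R), M (gam t))
    & has_deriv gam 0 1 v].
Proof.
(* This choice gives [T v v = 4 * a * eps], as [eps] has square 1. With [w = 1 / (1 + a t^2)] the
   curve stays on [M] because [(2 w - 1)^2 + 4 a t^2 w^2 = 1]. *)
move=> Mx vx; pose a := eps * T v v / 4.
pose d t : R := 1 + a * (t * t).
pose w t := (d t)^-1.
have hd : has_deriv d 0 1 0.
  apply: has_deriv_eq.
    apply: has_derivD (has_deriv_cst _ _ _) _; apply: has_derivM (has_deriv_cst _ _ _) _.
    exact: has_derivM (has_deriv_id _ _) (has_deriv_id _ _).
  by rewrite !(mulr0, mul0r, addr0, add0r).
have d0 : d 0 = 1 by rewrite /d !mulr0 addr0.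
have hw : has_deriv w 0 1 0.
  apply: has_deriv_eq.
    apply: (has_deriv_comp1 hd); apply: has_deriv_diff.
    by apply: differentiable_Rinv; rewrite d0 oner_neq0.
  by rewrite mulr0.
have w0 : w 0 = 1 by rewrite /w d0 invr1.
exists (fun t => (2 * w t - 1) *: x + (t * w t) *: v); split.
- by rewrite w0 mul0r scale0r addr0 (_ : 2 * 1 - 1 = 1) ?scale1r //; ring.
(* [d] has zeros when [a] is negative; near 0 the division is safe. *)
- have nz : \forall t \near (0 : R), d t != 0.
    apply: (near_preimage_open (B := [set y | y != 0]) _ hd); last first.
      by rewrite /= d0 oner_neq0.
    exact: open_neq.
  apply: filterS nz => t dt.
  rewrite /tsphere /= !(tdotDl, tdotDr, tdotZl, tdotZr) (tdotC x v symA) vx.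
  rewrite (Mx : T x x = eps).
  have e4 : T v v = 4 * a * eps.
    by rewrite -[LHS]mul1r -[X in X * _ = _]eps2 /a; move: (T v v) => r; field.
  by rewrite e4 /w; move: dt; rewrite /d; move: (a) => b dt; field.
- apply: has_deriv_eq.
    apply: has_derivD; apply: has_derivZl; last exact: has_derivM (has_deriv_id _ _) hw.
    apply: has_derivD (has_deriv_cst _ _ _).
    exact: has_derivM (has_deriv_cst _ _ _) hw.
  by rewrite w0 !(mul0r, mulr0, addr0, mulr1) scale0r add0r scale1r.
Qed.

(** [F] is known to vanish on the submanifold only, not on a neighbourhood, so it is composed with a
    curve that stays in both quadrics and has velocity [(v, vb)]. *)
Lemma derive_along_product (O : set (V * V)) (F : V * V -> R) (x xb v vb : V) d :
  open O -> O (x, xb) -> M x -> M xb -> T v x = 0 -> T vb xb = 0 ->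
  (forall p, (O `&` (M `*` M)) p -> F p = 0) ->
  has_deriv F (x, xb) (v, vb) d -> d = 0.
Proof.
move=> oO Op Mx Mxb vx vbxb F0 hF.
have [g [g0 Mg hg]] := tsphere_curve Mx vx.
have [h [h0 Mh hh]] := tsphere_curve Mxb vbxb.
have hp := has_deriv_pair hg hh.
rewrite -g0 -h0 in hF Op.
apply: has_deriv_unique (has_deriv_comp hp hF) (has_deriv_cst 0 (0 : R) 1).
apply: filterS3 Mg Mh (near_preimage_open oO hp Op) => t Mgt Mht Ot.
by apply: F0; split.
Qed.

(** Obtained by differentiating the tangency relations [T (Y p).1 p.1 = 0] and [T (Y p).2 p.2 = 0]
    along the submanifold. *)
Lemma tangent_field_derive (W O : set (V * V)) (Y : V * V -> V * V)
    (x xb : V) (v : V * V) :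
  open O -> (O `&` (M `*` M)) (x, xb) -> W (x, xb) ->
  tangent_field W (O `&` (M `*` M)) (tsphere2_tangent A) Y ->
  tsphere2_tangent A (x, xb) v ->
  let DY := 'D_v Y (x, xb) in
  T DY.1 x = - T (Y (x, xb)).1 v.1 /\ T DY.2 xb = - T (Y (x, xb)).2 v.2.
Proof.
move=> oO [Op [Mx Mxb]] Wp [[dY _] tY] [v1 v2] DY.
have hY := has_deriv_diff v (dY _ Wp).
have h1 := has_deriv_fst (has_deriv_id (x, xb) v).
have h2 := has_deriv_snd (has_deriv_id (x, xb) v).
have {}v1 := (tsphere_tangentE _ _).1 v1.
have {}v2 := (tsphere_tangentE _ _).1 v2.
have k1 := has_deriv_tdot A (has_deriv_fst hY) h1.
have k2 := has_deriv_tdot A (has_deriv_snd hY) h2.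
rewrite (surjective_pairing v) in k1 k2.
split; apply/eqP; rewrite -addr_eq0; apply/eqP.
  apply: (derive_along_product oO Op Mx Mxb v1 v2 _ k1).
  by move=> p /tY [+ _]; exact: (tsphere_tangentE _ _).1.
apply: (derive_along_product oO Op Mx Mxb v1 v2 _ k2).
by move=> p /tY [_ +]; exact: (tsphere_tangentE _ _).1.
Qed.

End TangentFields.

(** * The normal space of the submanifold *)

Section NormalSpace.
Context {R : realType} {q : nat} (A : 'M[R]_q) (u : nat -> R -> R) (eps : R).
Hypotheses (symA : A^T = A) (unitA : A \in unitmx) (eps2 : eps ^+ 2 = 1).
Local Notation V := 'rV[R]_q.
Local Notation T := (tdot A).
Local Notation M := (tsphere A eps).

Lemma tdot_nondeg (w : V) : (forall f, T w f = 0) -> w = 0.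
Proof.
move=> h; suff : w *m A = 0.
  by move/(congr1 (mulmx^~ (invmx A))); rewrite mulmxK // mul0mx.
apply/rowP => j; rewrite [RHS]mxE -(h (delta_mx 0 j)) /tdot [RHS]mxE.
rewrite (bigD1 j) //= big1 ?addr0 => [|i ij]; rewrite [X in _ * X]mxE [X in _ * X]mxE.
  by rewrite !eqxx mulr1.
by rewrite (negbTE ij) andbF mulr0.
Qed.

(** The cost is symmetric in its two variables; this transfers results on the first factor to the
    second. *)
Lemma jet12C (x xb a f : V) : jet12 A u x xb a f = jet12 A u xb x f a.
Proof.
rewrite /jet12 (tdotC xb x symA) (tdotC f x symA) (tdotC xb a symA).
by rewrite (tdotC f a symA); ring.
Qed.

Lemma jet112_jet122 (x xb a j k : V) :
  jet122 A u x xb a j k 0 = jet112 A u xb x j k 0 a.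
Proof.
rewrite /jet122 /jet112 !tdot0r !tdot0l (tdotC xb x symA) (tdotC xb a symA).
by rewrite (tdotC j a symA) (tdotC k a symA) (tdotC j x symA) (tdotC k x symA); ring.
Qed.

(* The direction Kim-McCann-orthogonal to the tangent spaces of M in the first
   factor, characterized by jet12_normal. *)
Definition normal_vec (x xb : V) : V :=
  let t := T x xb in
  (u 1%N t)^-1 *: (xb - (eps * u 2%N t / (u 1%N t + t * u 2%N t)) *: x).

(** The first two conditions make [jet12] nondegenerate on the ambient space; the third then makes
    [normal_norm] non-zero, so that [normal_vec] is transversal to the quadric. *)
Definition nondegenerate_at (t : R) : Prop :=
  [/\ u 1%N t != 0, u 1%N t + t * u 2%N t != 0
    & t * u 1%N t + (t ^+ 2 - 1) * u 2%N t != 0].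

(** The pairing of [normal_vec x xb] with [x], which is also the value of J on the two normal
    vectors. *)
Definition normal_norm (t : R) : R :=
  (t * u 1%N t + (t ^+ 2 - 1) * u 2%N t) / (u 1%N t * (u 1%N t + t * u 2%N t)).

Section AtPoint.
Variables x xb : V.
Hypotheses (Mx : M x) (Mxb : M xb) (nondeg : nondegenerate_at (T x xb)).

Lemma jet12_normal f : jet12 A u x xb (normal_vec x xb) f = T xb f.
Proof.
have [u10 det0 _] := nondeg; rewrite /jet12 /normal_vec.
rewrite !(tdotZl, tdotBl) (Mxb : T xb xb = eps).
move: u10 det0; move: (T x xb) (T x f) (T xb f) => t r1 r2.
by move: (u 1%N t) (u 2%N t) => u1 u2 u10 det0; field; apply/andP.
Qed.

Lemma tdot_normal : T (normal_vec x xb) x = normal_norm (T x xb).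
Proof.
have [u10 det0 _] := nondeg; rewrite /normal_vec /normal_norm.
rewrite !(tdotZl, tdotBl) (Mx : T x x = eps) (tdotC xb x symA).
move: u10 det0; move: (T x xb) => t.
move: (u 1%N t) (u 2%N t) => u1 u2 u10 det0.
rewrite (_ : _ * eps = eps ^+ 2 * u2 / (u1 + t * u2)); last by ring.
by rewrite eps2; field; apply/andP.
Qed.

Lemma normal_norm_neq0 : normal_norm (T x xb) != 0.
Proof.
have [u10 det0 h] := nondeg.
by rewrite /normal_norm mulf_neq0 // invr_eq0 mulf_neq0.
Qed.

(** The form J(d, .) is the pairing with a combination of [x] and [d], which must vanish. Pairing
    that combination with [xb] first gives [T d xb = 0], then [d = 0]. *)
Lemma jet12_nondeg (d : V) : (forall f, jet12 A u x xb d f = 0) -> d = 0.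
Proof.
have [u10 det0 _] := nondeg; move=> h.
have E : (u 2%N (T x xb) * T d xb) *: x + u 1%N (T x xb) *: d = 0.
  by apply: tdot_nondeg => f; rewrite -(h f) tdotDl !tdotZl.
have F : T d xb = 0.
  apply: (mulfI det0); rewrite mulr0 -(tdot0l A xb) -E tdotDl !tdotZl; ring.
move: E; rewrite F mulr0 scale0r add0r => /eqP.
by rewrite scaler_eq0 (negbTE u10) => /eqP.
Qed.

End AtPoint.

Lemma nondegenerateC (x xb : V) :
  nondegenerate_at (T x xb) -> nondegenerate_at (T xb x).
Proof. by rewrite (tdotC x xb symA). Qed.

Lemma jet12_normal_snd (x xb f : V) :
  M x -> M xb -> nondegenerate_at (T x xb) ->
  jet12 A u x xb f (normal_vec xb x) = T f x.
Proof.
move=> Mx Mxb /nondegenerateC h.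
by rewrite jet12C jet12_normal // (tdotC x f symA).
Qed.

(** After subtraction of the claimed multiple of [normal_vec x xb], the vector is J-orthogonal to
    the tangent space at [xb] and also to [normal_vec xb x]. These two span the whole space, so it
    is 0. *)
Lemma normal_component (x xb d : V) :
  M x -> M xb -> nondegenerate_at (T x xb) ->
  (forall f, T f xb = 0 -> jet12 A u x xb d f = 0) ->
  d = (T d x / normal_norm (T x xb)) *: normal_vec x xb.
Proof.
move=> Mx Mxb nd h; apply/eqP; rewrite -subr_eq0; apply/eqP.
have k0 := normal_norm_neq0 nd; set k := normal_norm _ in k0 *.
set l := T d x / k.
have ndC := nondegenerateC nd.
have kC : T (normal_vec xb x) xb = k by rewrite tdot_normal // (tdotC xb x symA).
have e f : jet12 A u x xb (d - l *: normal_vec x xb) f =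
    jet12 A u x xb d f - l * T xb f.
  by rewrite jet12Bl jet12Zl jet12_normal.
apply: (jet12_nondeg nd) => f.
pose m := T f xb / k; pose f' := f - m *: normal_vec xb x.
have f'0 : T f' xb = 0.
  by rewrite tdotBl tdotZl kC divfK // subrr.
have -> : f = f' + m *: normal_vec xb x by rewrite subrK.
rewrite jet12Dr jet12Zr !e h // (tdotC xb f' symA) f'0 mulr0 subrr add0r.
rewrite jet12_normal_snd // (tdotC xb _ symA) kC /l divfK //.
by rewrite subrr mulr0.
Qed.

End NormalSpace.

(** * The second fundamental form of the submanifold *)

Section SecondFundamentalForm.
Context {R : realType} {q : nat} (A : 'M[R]_q) (u : nat -> R -> R) (I : set R)
  (eps : R).
Hypotheses (oI : open I) (hu : deriv_seq 4 I u).
Hypotheses (symA : A^T = A) (unitA : A \in unitmx) (eps2 : eps ^+ 2 = 1).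
Local Notation V := 'rV[R]_q.
Local Notation T := (tdot A).
Local Notation M := (tsphere A eps).
Local Notation c := (fun x xb : V => u 0%N (tdot A x xb)).
Local Notation W := [set p : V * V | I (tdot A p.1 p.2)].
Local Notation J := (jet12 A u).
Local Notation nu := (normal_vec A u eps).
Local Notation kap := (normal_norm u).

Variables x xb : V.
Hypotheses (Mx : M x) (Mxb : M xb) (Ix : I (T x xb))
  (nondeg : nondegenerate_at u (T x xb)).

(** As [xget] selects some orthogonal tangent vector, uniqueness is proved along with existence: for
    any candidate [y], both components of [z - y] are normal, hence determined by
    [normal_component]. *)
Lemma orth_proj_cost (z : V * V) :
  z - orth_proj (KM c (x, xb)) (tsphere2_tangent A (x, xb)) z =
  ((T z.1 x / kap (T x xb)) *: nu x xb, (T z.2 xb / kap (T x xb)) *: nu xb x).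
Proof.
have k0 := normal_norm_neq0 nondeg; have nC := nondegenerateC symA nondeg.
set e := (X in _ = X).
have e1 : T e.1 x = T z.1 x by rewrite /e /= tdotZl tdot_normal // divfK.
have e2 : T e.2 xb = T z.2 xb.
  by rewrite /e /= tdotZl tdot_normal // (tdotC xb x symA) divfK.
suff -> : orth_proj (KM c (x, xb)) (tsphere2_tangent A (x, xb)) z = z - e.
  by rewrite opprB addrC subrK.
apply: xget_unique; first split.
- split; apply/(tsphere_tangentE symA) => /=.
    by rewrite tdotBl e1 subrr.
  by rewrite tdotBl e2 subrr.
- move=> w [/(tsphere_tangentE symA) w1 /(tsphere_tangentE symA) w2].
  rewrite opprB addrC subrK (KM_cost oI hu _ _ (Ix : W (x, xb))) /= jet12Zl jet12Zr.
  rewrite jet12_normal // jet12_normal_snd // (tdotC xb _ symA) w1 w2.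
  by rewrite !mulr0 addr0 mulr0.
- move=> y [[/(tsphere_tangentE symA) y1 /(tsphere_tangentE symA) y2] yo].
  have d1 : T (z - y).1 x = T z.1 x.
    by rewrite tdotBl y1 subr0.
  have d2 : T (z - y).2 xb = T z.2 xb.
    by rewrite tdotBl y2 subr0.
  have half0 : (- 2^-1 : R) != 0 by rewrite oppr_eq0 invr_eq0 pnatr_eq0.
  suff -> : e = z - y by rewrite opprB addrC subrK.
  rewrite [RHS]surjective_pairing /e -d1 -d2; congr (_, _); apply/esym.
    (* Tangent vectors of the form [(0, f)] test only the first component of [z - y]. *)
    apply: normal_component => // f f0; apply: (mulfI half0); rewrite mulr0.
    rewrite -(yo (0, f)); last first.
      by split; apply/(tsphere_tangentE symA); rewrite ?tdot0l.
    by rewrite (KM_cost oI hu _ _ (Ix : W (x, xb))) /= jet12_0l addr0.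
  rewrite (tdotC x xb symA); apply: normal_component => // f f0.
  apply: (mulfI half0); rewrite mulr0.
  rewrite -(yo (f, 0)); last first.
    by split; apply/(tsphere_tangentE symA); rewrite ?tdot0l.
  by rewrite (KM_cost oI hu _ _ (Ix : W (x, xb))) /= jet12_0r add0r jet12C.
Qed.

Variable nabla : (V * V -> V * V) -> (V * V -> V * V) -> V * V -> V * V.
Hypothesis nablaP : levi_civita W (KM c) nabla.
Variable O : set (V * V).
Hypotheses (oO : open O) (Op : O (x, xb)).
Local Notation N := (O `&` (M `*` M)).
Local Notation II := (second_fundamental_form (KM c) nabla (tsphere2_tangent A)).

(** Only the pairings of nabla_X Y with [x] and [xb] matter. Those of the Christoffel part are
    values of J on a normal vector, hence third derivatives of the cost; those of D_X Y come from
    [tangent_field_derive]. *)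
Lemma second_fundamental_formE (X Y : V * V -> V * V) :
  tangent_field W N (tsphere2_tangent A) X ->
  tangent_field W N (tsphere2_tangent A) Y ->
  let X1 := (X (x, xb)).1 in let X2 := (X (x, xb)).2 in
  let Y1 := (Y (x, xb)).1 in let Y2 := (Y (x, xb)).2 in
  II X Y (x, xb) =
  (((jet112 A u x xb X1 Y1 0 (nu xb x) - T Y1 X1) / kap (T x xb)) *: nu x xb,
   ((jet112 A u xb x X2 Y2 0 (nu x xb) - T Y2 X2) / kap (T x xb)) *: nu xb x).
Proof.
move=> [CX tX] tanY X1 X2 Y1 Y2; rewrite /second_fundamental_form orth_proj_cost.
have Np : N (x, xb) by [].
have [D1 D2] := tangent_field_derive symA eps2 oO Np Ix tanY (tX _ Np).
have [G1 G2] := christoffel_cost oI hu nablaP CX tanY.1 (Ix : W (x, xb)).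
have split_ : nabla X Y (x, xb) =
   (nabla X Y (x, xb) - 'D_(X (x, xb)) Y (x, xb)) + 'D_(X (x, xb)) Y (x, xb).
  by rewrite subrK.
move: split_ G1 G2; move: (nabla X Y (x, xb) - _) => G -> /= G1 G2.
rewrite !tdotDl D1 D2.
congr (_ * _ *: _, _ * _ *: _); congr (_ - _).
  by rewrite -G1 jet12_normal_snd.
by rewrite -jet112_jet122 // -G2 jet12_normal // (tdotC xb _ symA).
Qed.

End SecondFundamentalForm.

(** * Contraction of sums over coordinate indices *)

Section Contraction.
Context {R : realType} {V : lmodType R}.

(** Linearity in the pair [(a, b)], as opposed to bilinearity: a first derivative and the
    accompanying second derivative vary together. *)
Definition jointly_linear (G : V -> V -> R) : Prop :=
  forall k a a' b b', G (k *: a + a') (k *: b + b') = k * G a b + G a' b'.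

Lemma jointly_linear_sum m (G : V -> V -> R) (w : 'I_m -> R) (v v' : 'I_m -> V) :
  jointly_linear G ->
  \sum_(i < m) w i * G (v i) (v' i) =
  G (\sum_(i < m) w i *: v i) (\sum_(i < m) w i *: v' i).
Proof.
move=> linG; have G0 : G 0 0 = 0.
  have := linG 1 0 0 0 0; rewrite !scaler0 !addr0 mul1r => /eqP.
  by rewrite -subr_eq subrr eq_sym => /eqP.
elim: m w v v' => [|m IH] w v v'; first by rewrite !big_ord0 G0.
by rewrite !big_ord_recl linG IH.
Qed.

Lemma jointly_linear_big m (G : 'I_m -> V -> V -> R) :
  (forall i, jointly_linear (G i)) ->
  jointly_linear (fun a b => \sum_(i < m) G i a b).
Proof.
move=> h k a a' b b'; rewrite big_distrr -big_split.
by apply: eq_bigr => i _; rewrite h.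
Qed.

Lemma jointly_linearMl (G : V -> V -> R) r :
  jointly_linear G -> jointly_linear (fun a b => r * G a b).
Proof. by move=> h k a a' b b'; rewrite h; ring. Qed.

Lemma jointly_linearMr (G : V -> V -> R) r :
  jointly_linear G -> jointly_linear (fun a b => G a b * r).
Proof. by move=> h k a a' b b'; rewrite h; ring. Qed.

Lemma jointly_linearB (G G' : V -> V -> R) :
  jointly_linear G -> jointly_linear G' ->
  jointly_linear (fun a b => G a b - G' a b).
Proof. by move=> h h' k a a' b b'; rewrite h h'; ring. Qed.

(* Functions of two first derivatives and the corresponding second derivative
   that the chain rule produces. *)
Definition second_order (F : V -> V -> V -> R) : Prop :=
  (forall b, jointly_linear (fun a c => F a b c)) /\
  (forall a, jointly_linear (fun b c => F a b c)).

(** The sum over [l] is absorbed by the second and third arguments, then the sum over [i] by the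
    first and third. *)
Lemma second_order_sum m (F : V -> V -> V -> R) (w : 'I_m -> R) (v : 'I_m -> V)
    (v2 : 'I_m -> 'I_m -> V) : second_order F ->
  \sum_(i < m) \sum_(l < m) w i * w l * F (v i) (v l) (v2 i l) =
  F (\sum_(i < m) w i *: v i) (\sum_(i < m) w i *: v i)
    (\sum_(i < m) w i *: \sum_(l < m) w l *: v2 i l).
Proof.
move=> [F1 F2]; rewrite -(jointly_linear_sum w v _ (F1 _)); apply: eq_bigr => i _.
rewrite -(jointly_linear_sum w v _ (F2 _)) big_distrr; apply: eq_bigr => l _.
by rewrite /= mulrA.
Qed.

End Contraction.

(** * The cross-curvature in parametrized coordinates *)

Section CrossOfCost.
Context {R : realType} {q m : nat} (A : 'M[R]_q) (u : nat -> R -> R).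
Local Notation T := (tdot A).
Local Notation V := 'rV[R]_q.

Lemma jet112_second_order x xb f :
  second_order (fun i l il => jet112 A u x xb i l il f).
Proof.
by split=> [b k a a' c c'|a k b b' c c'];
  rewrite /jet112 !(tdotDl, tdotZl); ring.
Qed.

Lemma jet122_second_order x xb a : second_order (jet122 A u x xb a).
Proof.
by split=> [b k d d' c c'|d k b b' c c'];
  rewrite /jet122 !(tdotDr, tdotZr); ring.
Qed.

Lemma jet1122_second_order_fst x xb j k jk :
  second_order (fun i l il => jet1122 A u x xb i l il j k jk).
Proof.
by split=> [b r a a' c c'|a r b b' c c'];
  rewrite /jet1122 !(tdotDl, tdotZl); ring.
Qed.

Lemma jet1122_second_order_snd x xb i l il :
  second_order (jet1122 A u x xb i l il).
Proof.
by split=> [b r a a' c c'|a r b b' c c'];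
  rewrite /jet1122 !(tdotDr, tdotZr); ring.
Qed.

Context (I : set R) (U Ub : set 'rV[R]_m) (phi psi : 'rV[R]_m -> V).
Hypotheses (oI : open I) (oU : open U) (oUb : open Ub)
  (hu : deriv_seq 4 I u) (hphi : cont_diff 2 U phi) (hpsi : cont_diff 2 Ub psi).
Local Notation C := (fun z zb => u 0%N (T (phi z) (psi zb))).
Variables (y yb w wb : 'rV[R]_m).
Hypothesis Oy : cost_domain A I U Ub phi psi y yb.

Local Notation x := (phi y).
Local Notation xb := (psi yb).
Let phi1 i := 'D_(e_ i) phi y.
Let phi2 i l := 'D_(e_ i) ('D_(e_ l) phi) y.
Let psi1 i := 'D_(e_ i) psi yb.
Let psi2 i l := 'D_(e_ i) ('D_(e_ l) psi) yb.
Let xi := \sum_(i < m) w 0 i *: phi1 i.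
Let xib := \sum_(i < m) wb 0 i *: psi1 i.
Let xi2 := \sum_(i < m) w 0 i *: \sum_(l < m) w 0 l *: phi2 i l.
Let xib2 := \sum_(i < m) wb 0 i *: \sum_(l < m) wb 0 l *: psi2 i l.

Definition cost_hessian : 'M[R]_m :=
  \matrix_(a, f) jet12 A u x xb (phi1 a) (psi1 f).

Lemma mixed_hessian_cost : mixed_hessian C y yb = cost_hessian.
Proof.
apply/matrixP => a f; rewrite !mxE.
exact: (D1D2_cost oI oU oUb hu hphi hpsi).
Qed.

(** All jets are of second order in the derivatives of each parametrization, so the four outer sums
    collapse to jets at [xi], [xi2], [xib], [xib2]. *)
Lemma cross_cost_contracted :
  cross C y yb w wb = 2^-1 *
    ((\sum_(a < m) \sum_(f < m) jet112 A u x xb xi xi xi2 (psi1 f)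
        * mixed_inverse C y yb a f * jet122 A u x xb (phi1 a) xib xib xib2)
     - jet1122 A u x xb xi xi xi2 xib xib xib2).
Proof.
rewrite /cross; congr (_ * _); set K := mixed_inverse C y yb.
pose F i l il j k jk : R :=
  (\sum_(a < m) \sum_(f < m) jet112 A u x xb i l il (psi1 f)
        * K a f * jet122 A u x xb (phi1 a) j k jk)
  - jet1122 A u x xb i l il j k jk.
have F_fst j k jk : second_order (fun i l il => F i l il j k jk).
  by split=> b; apply: jointly_linearB; try (
    apply: jointly_linear_big => a; apply: jointly_linear_big => f;
    do 2!apply: jointly_linearMr);
    [exact: (jet112_second_order _ _ _).1
    |exact: (jet1122_second_order_fst _ _ _ _ _).1
    |exact: (jet112_second_order _ _ _).2
    |exact: (jet1122_second_order_fst _ _ _ _ _).2].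
have F_snd i l il : second_order (F i l il).
  by split=> b; apply: jointly_linearB; try (
    apply: jointly_linear_big => a; apply: jointly_linear_big => f;
    apply: jointly_linearMl);
    [exact: (jet122_second_order _ _ _).1
    |exact: (jet1122_second_order_snd _ _ _ _ _).1
    |exact: (jet122_second_order _ _ _).2
    |exact: (jet1122_second_order_snd _ _ _ _ _).2].
rewrite -/(F xi xi xi2 xib xib xib2) /xi /xi2.
rewrite -(second_order_sum (fun i => w 0 i) phi1 phi2 (F_fst _ _ _)).
apply: eq_bigr => i _; apply: eq_bigr => l _.
rewrite -(second_order_sum (fun i => wb 0 i) psi1 psi2 (F_snd _ _ _)).
rewrite big_distrr; apply: eq_bigr => j _; rewrite big_distrr.
apply: eq_bigr => k _ /=; rewrite !mulrA; congr (_ * (_ - _)); last first.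
  exact: (D1D1D2D2_cost oI oU oUb hu hphi hpsi).
apply: eq_bigr => a _; apply: eq_bigr => f _; congr (_ * _ * _).
  exact: (D1D1D2_cost oI oU oUb hu hphi hpsi).
exact: (D1D2D2_cost oI oU oUb hu hphi hpsi).
Qed.

(** If the third derivatives are J(alpha, .) and J(., beta) on the frames, and [alpha] has
    coordinates [d] in the first frame, then the row of the former is [d] times the Hessian. The
    inverse Hessian cancels and J(alpha, beta) is left; [beta] may be any vector. *)
Lemma cross_cost (d : 'rV[R]_m) (beta : V) : cost_hessian \in unitmx ->
  let alpha := \sum_(a < m) d 0 a *: phi1 a in
  (forall f, jet112 A u x xb xi xi xi2 (psi1 f) = jet12 A u x xb alpha (psi1 f)) ->
  (forall a, jet122 A u x xb (phi1 a) xib xib xib2 = jet12 A u x xb (phi1 a) beta) ->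
  cross C y yb w wb =
  2^-1 * (jet12 A u x xb alpha beta - jet1122 A u x xb xi xi xi2 xib xib xib2).
Proof.
move=> uH alpha hP hQ; rewrite cross_cost_contracted; congr (_ * (_ - _)).
pose Q : 'cV[R]_m := \col_a jet12 A u x xb (phi1 a) beta.
have jl b : jointly_linear (fun a _ : V => jet12 A u x xb a b).
  by move=> k a a' _ _; rewrite jet12Dl jet12Zl.
have E : \row_f jet12 A u x xb alpha (psi1 f) = d *m cost_hessian.
  apply/rowP => f; rewrite !mxE /alpha.
  rewrite -(jointly_linear_sum _ _ (fun=> 0) (jl _)).
  by apply: eq_bigr => a _; rewrite !mxE.
have -> : jet12 A u x xb alpha beta = (d *m Q) 0 0.
  rewrite mxE -(jointly_linear_sum _ _ (fun=> 0) (jl _)).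
  by apply: eq_bigr => a _; rewrite !mxE.
(* The transpose in [mixed_inverse] turns the double sum into the product row, inverse Hessian,
   column. *)
rewrite -(mulmxK uH d) -E [RHS]mxE; apply: eq_bigr => a _; rewrite !mxE -hQ.
rewrite big_distrl; apply: eq_bigr => f _.
by rewrite hP !mxE /= mixed_hessian_cost.
Qed.

End CrossOfCost.

(** A form of [cross_cost] in which base points, frames and second derivatives enter through
    equations, for use with the identity as well as with charts. *)
Lemma cross_cost_at {R : realType} {q m : nat} (A : 'M[R]_q) (u : nat -> R -> R)
    (I : set R) (U Ub : set 'rV[R]_m) (phi psi : 'rV[R]_m -> 'rV[R]_q)
    (y yb w wb : 'rV[R]_m) (x xb xi xib xi2 xib2 : 'rV[R]_q)
    (phi1 psi1 : 'I_m -> 'rV[R]_q) (d : 'rV[R]_m) (beta : 'rV[R]_q) :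
  open I -> open U -> open Ub -> deriv_seq 4 I u ->
  cont_diff 2 U phi -> cont_diff 2 Ub psi ->
  U y -> Ub yb -> I (tdot A x xb) -> phi y = x -> psi yb = xb ->
  (forall i, 'D_(e_ i) phi y = phi1 i) -> (forall i, 'D_(e_ i) psi yb = psi1 i) ->
  \sum_(i < m) w 0 i *: phi1 i = xi -> \sum_(i < m) wb 0 i *: psi1 i = xib ->
  \sum_(i < m) w 0 i *: \sum_(l < m) w 0 l *: 'D_(e_ i) ('D_(e_ l) phi) y = xi2 ->
  \sum_(i < m) wb 0 i *: \sum_(l < m) wb 0 l *: 'D_(e_ i) ('D_(e_ l) psi) yb
    = xib2 ->
  (\matrix_(a, f) jet12 A u x xb (phi1 a) (psi1 f) : 'M[R]_m) \in unitmx ->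
  let alpha := \sum_(a < m) d 0 a *: phi1 a in
  (forall f, jet112 A u x xb xi xi xi2 (psi1 f) = jet12 A u x xb alpha (psi1 f)) ->
  (forall a, jet122 A u x xb (phi1 a) xib xib xib2 = jet12 A u x xb (phi1 a) beta) ->
  cross (fun z zb => u 0%N (tdot A (phi z) (psi zb))) y yb w wb =
  2^-1 * (jet12 A u x xb alpha beta - jet1122 A u x xb xi xi xi2 xib xib xib2).
Proof.
move=> oI oU oUb hu hphi hpsi Uy Ubyb + px pxb /funext p1 /funext p1b.
subst x xb phi1 psi1 => Ix <- <- <- <- uH alpha hP hQ.
exact: (cross_cost oI oU oUb hu hphi hpsi _ uH hP hQ).
Qed.

(** * Frames and transversal vectors *)

Section LinearAlgebra.
Context {R : realType}.

Lemma derive_basis {W : normedModType R} m (f : 'rV[R]_m -> W) (y w : 'rV[R]_m) :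
  differentiable f y -> 'D_w f y = \sum_(i < m) w 0 i *: 'D_(e_ i) f y.
Proof.
move=> df; rewrite deriveE // {1}(row_sum_delta w) linear_sum.
by apply: eq_bigr => i _; rewrite linearZ deriveE.
Qed.

Lemma unitmx_ker m (H : 'M[R]_m) :
  (forall d : 'rV[R]_m, d *m H = 0 -> d = 0) -> H \in unitmx.
Proof.
move=> h; rewrite -row_free_unit -kermx_eq0; apply/rowV0P => v /sub_kermxP.
exact: h.
Qed.

(** The [n] independent vectors lie in the hyperplane [T _ x = 0] and [nu] does not, so together
    they form a basis; pairing with [x] reads off the coefficient of [nu]. *)
Lemma span_transversal n (A : 'M[R]_n.+1) (v : 'I_n -> 'rV[R]_n.+1)
    (x nu al : 'rV[R]_n.+1) :
  (forall d : 'rV[R]_n, \sum_i d 0 i *: v i = 0 -> d = 0) ->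
  (forall i, tdot A (v i) x = 0) -> tdot A nu x != 0 ->
  exists d : 'rV[R]_n,
    al = \sum_i d 0 i *: v i + (tdot A al x / tdot A nu x) *: nu.
Proof.
move=> free vx nux.
pose Phi : 'M[R]_(n, n.+1) := \matrix_i v i.
have PhiE (d : 'rV[R]_n) : d *m Phi = \sum_i d 0 i *: v i.
  by rewrite mulmx_sum_row; apply: eq_bigr => i _; rewrite rowK.
have Phix (d : 'rV[R]_n) : tdot A (d *m Phi) x = 0.
  rewrite PhiE; elim/big_ind: _ => [|a b ha hb|i _]; first exact: tdot0l.
    by rewrite tdotDl ha hb addr0.
  by rewrite tdotZl vx mulr0.
pose B : 'M[R]_(1 + n) := col_mx nu Phi.
have BE (d : 'rV[R]_(1 + n)) : d *m B = lsubmx d 0 0 *: nu + rsubmx d *m Phi.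
  rewrite -{1}(hsubmxK d) mul_row_col; congr (_ + _).
  by rewrite {1}(mx11_scalar (lsubmx d)) mul_scalar_mx.
have Bx (d : 'rV[R]_(1 + n)) : tdot A (d *m B) x = lsubmx d 0 0 * tdot A nu x.
  by rewrite BE tdotDl tdotZl Phix addr0.
have uB : B \in unitmx.
  apply: (@unitmx_ker (1 + n)) => d dB.
  have l0 : lsubmx d 0 0 = 0.
    by apply: (mulIf nux); rewrite -Bx dB tdot0l mul0r.
  move: dB; rewrite BE l0 scale0r add0r PhiE => /free r0.
  by rewrite -(hsubmxK d) r0 (mx11_scalar (lsubmx d)) l0 raddf0 row_mx0.
pose d : 'rV[R]_(1 + n) := al *m invmx B.
have dE : al = d *m B by rewrite mulmxKV.
exists (rsubmx d); rewrite -PhiE {2}dE Bx mulfK // addrC -BE.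
exact: dE.
Qed.

End LinearAlgebra.

(** * Cross-curvature of the ambient cost and of its restriction to the quadrics *)

Section CrossCurvature.
Context {R : realType} {n : nat} (A : 'M[R]_n.+1) (u : nat -> R -> R)
  (I : set R) (eps : R).
Hypotheses (oI : open I) (hu : deriv_seq 4 I u).
Hypotheses (symA : A^T = A) (unitA : A \in unitmx) (eps2 : eps ^+ 2 = 1).
Local Notation V := 'rV[R]_n.+1.
Local Notation T := (tdot A).
Local Notation M := (tsphere A eps).
Local Notation c := (fun x xb : V => u 0%N (tdot A x xb)).
Local Notation J := (jet12 A u).
Local Notation nu := (normal_vec A u eps).
Local Notation kap := (normal_norm u).

(** The solution [G] of J(G, f) = [jet112 A u x xb xi xi 0 f]. The number [g] is [T G xb], obtained
    by taking [f] through the pairing with [xb]; once it is known, the equation gives [G]. *)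
Definition christoffel_vec (x xb xi : V) : V :=
  let t := T x xb in let p := T xi xb in
  let g := (2 * u 2%N t * p ^+ 2 + u 3%N t * p ^+ 2 * t)
           / (u 1%N t + t * u 2%N t) in
  (u 1%N t)^-1 *: ((2 * u 2%N t * p) *: xi + (u 3%N t * p ^+ 2 - u 2%N t * g) *: x).
Local Notation Gam := christoffel_vec.

Lemma jet12_christoffel x xb xi f : nondegenerate_at u (T x xb) ->
  J x xb (Gam x xb xi) f = jet112 A u x xb xi xi 0 f.
Proof.
move=> [u10 det0 _]; rewrite /jet12 /jet112 /christoffel_vec.
rewrite !(tdotZl, tdotDl) !tdot0l; move: u10 det0.
move: (T x xb) (T xi xb) (T x f) (T xi f) => t p r1 r2.
move: (u 1%N t) (u 2%N t) (u 3%N t) => u1 u2 u3 u10 det0.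
by field; apply/andP.
Qed.

Lemma jet12_christoffel_snd x xb xib a : nondegenerate_at u (T x xb) ->
  J x xb a (Gam xb x xib) = jet122 A u x xb a xib xib 0.
Proof.
move=> nd; rewrite jet12C // jet12_christoffel ?jet112_jet122 //.
exact: nondegenerateC.
Qed.

Section AtPoint.
Variables x xb : V.
Hypotheses (Mx : M x) (Mxb : M xb) (Ix : I (T x xb))
  (nondeg : nondegenerate_at u (T x xb)).

Lemma sum_basis (d : V) : \sum_(i < n.+1) d 0 i *: e_ i = d.
Proof. by rewrite [RHS]row_sum_delta. Qed.

(** Here both parametrizations are the identity, whose second derivatives vanish, and the
    representing vectors are the Christoffel vectors. *)
Lemma cross_ambient (xi xib : V) : cross c x xb xi xib =
  2^-1 * (J x xb (Gam x xb xi) (Gam xb x xib)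
          - jet1122 A u x xb xi xi 0 xib xib 0).
Proof.
have D1 v y : 'D_v (id : V -> V) y = v by exact: derive_id.
have D2 (d z : V) : \sum_(i < n.+1) d 0 i *:
    \sum_(l < n.+1) d 0 l *: 'D_(e_ i) ('D_(e_ l) (id : V -> V)) z = 0.
  rewrite big1 // => i _; rewrite big1 ?scaler0 // => l _.
  rewrite (_ : 'D_(e_ l) id = cst (e_ l)) ?derive_cst ?scaler0 //.
  by apply/funext => v; exact: D1.
rewrite -(sum_basis (Gam x xb xi)).
apply: (cross_cost_at (I := I) (U := setT) (Ub := setT) (phi := id) (psi := id)) => //.
- exact: openT.
- exact: openT.
- exact: cont_diff_id.
- exact: cont_diff_id.
- exact: sum_basis.
- exact: sum_basis.
- apply: unitmx_ker => d dH; apply: (jet12_nondeg unitA nondeg) => f.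
  have jl b : jointly_linear (fun a _ : V => J x xb a b).
    by move=> k a a' _ _; rewrite jet12Dl jet12Zl.
  have jr a : jointly_linear (fun b _ : V => J x xb a b).
    by move=> k b b' _ _; rewrite jet12Dr jet12Zr.
  rewrite -(sum_basis f) -(jointly_linear_sum _ _ (fun=> 0) (jr _)).
  rewrite big1 // => j _; rewrite -(sum_basis d).
  rewrite -(jointly_linear_sum _ _ (fun=> 0) (jl _)).
  move/(congr1 (fun B : 'rV_n.+1 => B 0 j)): dH; rewrite !mxE => dH.
  suff -> : \sum_(i < n.+1) d 0 i * J x xb (e_ i) (e_ j) = 0 by rewrite mulr0.
  by apply: etrans dH; apply: eq_bigr => i _; rewrite mxE.
- by move=> f; rewrite sum_basis jet12_christoffel.
- by move=> a; rewrite jet12_christoffel_snd.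
Qed.

End AtPoint.

Section Immersion.
Context (U : set 'rV[R]_n) (phi : 'rV[R]_n -> V).
Hypotheses (oU : open U) (hphi : cont_diff 2 U phi)
  (Mphi : forall z, U z -> M (phi z)).

Lemma immersion_tangent z v : U z -> T ('D_v phi z) (phi z) = 0.
Proof.
move=> Uz; have h := has_deriv_diff v (hphi.1 z Uz).
have := has_deriv_unique _ (has_deriv_tdot A h h) (has_deriv_cst eps z v).
rewrite (tdotC (phi z) _ symA) => /(_ _)/eqP.
rewrite -mulr2n -mulr_natr mulf_eq0 pnatr_eq0 orbF => h0; apply/eqP/h0.
by apply: filterS (open_nbhs_nbhs (conj oU Uz)) => ?; exact: Mphi.
Qed.

Lemma immersion_second z v v' : U z ->
  T ('D_v ('D_v' phi) z) (phi z) = - T ('D_v' phi z) ('D_v phi z).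
Proof.
move=> Uz; have h := has_deriv_diff v (hphi.1 z Uz).
have h' := has_deriv_diff v ((hphi.2 v').1 z Uz).
apply/eqP; rewrite -addr_eq0; apply/eqP.
apply: has_deriv_unique _ (has_deriv_tdot A h' h) (has_deriv_cst 0 z v).
apply: filterS (open_nbhs_nbhs (conj oU Uz)) => ?; exact: immersion_tangent.
Qed.

(** The sum is the second derivative of [phi] along [w] taken twice. Adding the right-hand side and
    contracting backwards leaves terms that vanish one by one by [immersion_second]. *)
Lemma immersion_acceleration z (w : 'rV[R]_n) : U z ->
  T (\sum_(i < n) w 0 i *: \sum_(l < n) w 0 l *: 'D_(e_ i) ('D_(e_ l) phi) z)
    (phi z) = - T ('D_w phi z) ('D_w phi z).
Proof.
move=> Uz; apply/eqP; rewrite -addr_eq0 derive_basis; last exact: hphi.1.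
have F2 : second_order (fun i l il : V => T il (phi z) + T i l).
  by split=> [b k a a' e e'|a k b b' e e'];
    rewrite !(tdotDl, tdotDr, tdotZl, tdotZr); ring.
rewrite -(second_order_sum _ _ (fun i l => 'D_(e_ i) ('D_(e_ l) phi) z) F2).
rewrite big1 // => i _; rewrite big1 // => l _.
by rewrite immersion_second // (tdotC _ _ symA) addNr mulr0.
Qed.

End Immersion.

(** The last three terms also occur when J is expanded at sums of a Christoffel vector and an
    acceleration, so they cancel in the cross-curvature. *)
Lemma jet1122_split (x xb xi xi2 xib xib2 : V) :
  jet1122 A u x xb xi xi xi2 xib xib xib2 =
  jet1122 A u x xb xi xi 0 xib xib 0 + jet122 A u x xb xi2 xib xib 0
  + jet112 A u x xb xi xi 0 xib2 + J x xb xi2 xib2.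
Proof. by rewrite /jet1122 /jet122 /jet112 /jet12 !tdot0l !tdot0r; ring. Qed.

(** The restricted Hessian sees only the tangential part of Christoffel vector plus acceleration;
    dropping the normal part produces the correction term. *)
Lemma cross_pullback (U Ub : set 'rV[R]_n) (phi psi : 'rV[R]_n -> V)
    (y yb w wb : 'rV[R]_n) (x xb xi xib : V) :
  M x -> M xb -> I (T x xb) -> nondegenerate_at u (T x xb) ->
  open U -> open Ub -> cont_diff 2 U phi -> cont_diff 2 Ub psi ->
  (forall z, U z -> M (phi z)) -> (forall z, Ub z -> M (psi z)) ->
  U y -> Ub yb -> phi y = x -> psi yb = xb ->
  (forall v, 'D_v phi y = 0 -> v = 0) -> (forall v, 'D_v psi yb = 0 -> v = 0) ->
  'D_w phi y = xi -> 'D_wb psi yb = xib ->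
  cross (fun z zb => u 0%N (T (phi z) (psi zb))) y yb w wb =
  cross c x xb xi xib
  - 2^-1 * ((jet112 A u x xb xi xi 0 (nu xb x) - T xi xi) *
            (jet112 A u xb x xib xib 0 (nu x xb) - T xib xib) / kap (T x xb)).
Proof.
move=> Mx Mxb Ix nd oU oUb hphi hpsi Mphi Mpsi Uy Ubyb px pxb immp immpb wxi wxib.
have k0 := normal_norm_neq0 nd; have ndC := nondegenerateC symA nd.
have dphi : differentiable phi y by exact: hphi.1.
have dpsi : differentiable psi yb by exact: hpsi.1.
(* The existential makes the acceleration an opaque variable. *)
have [xi2 xi2E] : exists v, \sum_(i < n) w 0 i *: \sum_(l < n) w 0 l *:
  'D_(e_ i) ('D_(e_ l) phi) y = v by exact: ex_intro _ _ erefl.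
have [xib2 xib2E] : exists v, \sum_(i < n) wb 0 i *: \sum_(l < n) wb 0 l *:
  'D_(e_ i) ('D_(e_ l) psi) yb = v by exact: ex_intro _ _ erefl.
have xi2x : T xi2 x = - T xi xi.
  by rewrite -px -wxi -xi2E; exact: immersion_acceleration oU hphi Mphi _ _ Uy.
have xib2x : T xib2 xb = - T xib xib.
  by rewrite -pxb -wxib -xib2E; exact: immersion_acceleration oUb hpsi Mpsi _ _ Ubyb.
have tphi i : T ('D_(e_ i) phi y) x = 0.
  by rewrite -px; exact: (immersion_tangent oU hphi Mphi).
have tpsi i : T ('D_(e_ i) psi yb) xb = 0.
  by rewrite -pxb; exact: (immersion_tangent oUb hpsi Mpsi).
have kx : T (nu x xb) x = kap (T x xb) by rewrite tdot_normal.
have kxb : T (nu xb x) xb = kap (T x xb).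
  by rewrite tdot_normal // (tdotC xb x symA).
have frphi (d : 'rV[R]_n) : \sum_i d 0 i *: 'D_(e_ i) phi y = 0 -> d = 0.
  by move=> d0; apply: immp; rewrite derive_basis.
have frpsi (d : 'rV[R]_n) : \sum_i d 0 i *: 'D_(e_ i) psi yb = 0 -> d = 0.
  by move=> d0; apply: immpb; rewrite derive_basis.
have jl b : jointly_linear (fun a _ : V => J x xb a b).
  by move=> k a a' _ _; rewrite jet12Dl jet12Zl.
have jr a : jointly_linear (fun b _ : V => J x xb a b).
  by move=> k b b' _ _; rewrite jet12Dr jet12Zr.
have [al alE] : exists al, al = Gam x xb xi + xi2
  by exact: ex_intro _ _ erefl.
have [be beE] : exists be, be = Gam xb x xib + xib2
  by exact: ex_intro _ _ erefl.
have alx : T al x = jet112 A u x xb xi xi 0 (nu xb x) - T xi xi.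
  by rewrite alE tdotDl xi2x -jet12_christoffel // jet12_normal_snd.
have bexb : T be xb = jet112 A u xb x xib xib 0 (nu x xb) - T xib xib.
  by rewrite beE tdotDl xib2x -jet12_christoffel // jet12_normal_snd.
rewrite -alx -bexb.
have [|d dE] := span_transversal al frphi tphi (nu := nu x xb); first by rewrite kx.
(* The tangential part of [al]. It represents the same third derivatives on the frame of [psi],
   since J(nu, .) vanishes on vectors tangent at [xb]. *)
pose alt := \sum_i d 0 i *: 'D_(e_ i) phi y.
have altE : alt = al - (T al x / kap (T x xb)) *: nu x xb.
  by rewrite -kx {1}dE addrK.
rewrite (cross_cost_at (I := I) (U := U) (Ub := Ub) (x := x) (xb := xb)
  (xi := xi) (xib := xib) (xi2 := xi2) (xib2 := xib2) (d := d) (beta := be)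
  oI oU oUb hu hphi hpsi Uy Ubyb Ix px pxb (fun=> erefl) (fun=> erefl)) //.
- rewrite -/alt altE cross_ambient // jet12Bl jet12Zl jet12_normal //.
  rewrite (tdotC xb be symA); move: (T al x) (T be xb) (kap _) => r1 r2 k.
  rewrite alE beE jet12Dl !jet12Dr !jet12_christoffel //.
  rewrite jet12_christoffel_snd //.
  rewrite jet1122_split.
  move: (jet1122 _ _ _ _ _ _ _ _ _ _) (jet112 _ _ _ _ _ _ _ _) => r3 r4.
  move: (jet112 _ _ _ _ _ _ _ _) (jet122 _ _ _ _ _ _ _ _) (J _ _ _ _) => r5 r6 r7.
  by ring.
- by rewrite -wxi derive_basis.
- by rewrite -wxib derive_basis.
(* A tangent vector [z] that is J-orthogonal to the frame of [psi] is also J-orthogonal to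
   [nu xb x], because [T z x = 0]; hence it is J-orthogonal to everything. *)
- apply: unitmx_ker => e eH; apply: frphi; apply: (jet12_nondeg unitA nd) => f.
  set z := \sum_i _.
  have [|e' ->] := span_transversal f frpsi tpsi (nu := nu xb x); first by rewrite kxb.
  rewrite jet12Dr jet12Zr jet12_normal_snd //.
  have -> : T z x = 0.
    rewrite /z; elim/big_ind: _ => [|a b ha hb|i _]; first exact: tdot0l.
      by rewrite tdotDl ha hb addr0.
    by rewrite tdotZl tphi mulr0.
  rewrite mulr0 addr0 -(jointly_linear_sum _ _ (fun=> 0) (jr _)).
  rewrite big1 // => j _; rewrite /z -(jointly_linear_sum _ _ (fun=> 0) (jl _)).
  move/(congr1 (fun B : 'rV_n => B 0 j)): eH; rewrite !mxE => eH.
  suff -> : \sum_(i < n) e 0 i * J x xb ('D_(e_ i) phi y) ('D_(e_ j) psi yb) = 0.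
    by rewrite mulr0.
  by apply: etrans eH; apply: eq_bigr => i _; rewrite mxE.
- move=> f; rewrite -/alt altE jet12Bl jet12Zl jet12_normal //.
  rewrite (tdotC xb _ symA) tpsi mulr0 subr0 alE jet12Dl jet12_christoffel //.
  by rewrite /jet112 /jet12 !tdot0l; ring.
- move=> a; rewrite beE jet12Dr jet12_christoffel_snd //.
  by rewrite /jet122 /jet12 !tdot0r; ring.
Qed.

End CrossCurvature.

(** * The explicit formulas in terms of [s] *)

Section GaussCodazzi.
Context {R : realType} {n : nat} (A : 'M[R]_n.+1) (u s : nat -> R -> R)
  (I L : set R) (eps : R).
Hypotheses (oI : open I) (hu : deriv_seq 4 I u) (hs : deriv_seq 4 L s)
  (IL : forall t, I t -> L (u 0%N t)) (su : forall t, I t -> s 0%N (u 0%N t) = t)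
  (s_nondeg : forall v, L v ->
     (- s 0%N v * s 1%N v ^+ 2 + s 2%N v * (s 0%N v ^+ 2 - 1)) *
     (s 1%N v ^+ 2 - s 2%N v * s 0%N v) * s 1%N v != 0).
Hypotheses (symA : A^T = A) (unitA : A \in unitmx) (eps2 : eps ^+ 2 = 1).
Local Notation V := 'rV[R]_n.+1.
Local Notation T := (tdot A).
Local Notation M := (tsphere A eps).
Local Notation c := (fun x xb : V => u 0%N (tdot A x xb)).
Local Notation W := [set p : V * V | I (tdot A p.1 p.2)].

(** Substituting the derivatives of [u] turns the three conditions into the factors of [s_nondeg],
    up to sign and powers of [s1]. *)
Lemma cost_nondegenerate t : I t -> nondegenerate_at u t.
Proof.
move=> It; have [s10 E1 E2 _ _] := inverse_derivatives oI hu hs IL su It.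
have := s_nondeg (IL It); rewrite su // !mulf_eq0 !negb_or => /andP[/andP[h1 h2] _].
rewrite /nondegenerate_at {}E1 {}E2; move: s10 h1 h2.
move: (s 1%N _) (s 2%N _) => s1 s2 s10 h1 h2; split.
- by rewrite invr_eq0.
- rewrite (_ : _ + _ = (s1 ^+ 2 - s2 * t) / s1 ^+ 3); last by field.
  by rewrite mulf_neq0 // invr_eq0 expf_neq0.
- rewrite (_ : _ + _ = - (- t * s1 ^+ 2 + s2 * (t ^+ 2 - 1)) / s1 ^+ 3); last by field.
  by rewrite mulf_neq0 ?oppr_eq0 // invr_eq0 expf_neq0.
Qed.

Variables x xb : V.
Hypotheses (Mx : M x) (Mxb : M xb) (Ix : I (T x xb)).
Local Notation s0 := (T x xb).
Local Notation s1 := (s 1%N (u 0%N s0)).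
Local Notation s2 := (s 2%N (u 0%N s0)).
Local Notation s3 := (s 3%N (u 0%N s0)).
Local Notation s4 := (s 4%N (u 0%N s0)).

Lemma cross_ambientE (xi xib : V) :
  let km := KM c (x, xb) (xi, xib) (xi, xib) in
  cross c x xb xi xib =
    ((s1 ^+ 2 - s0 * s2) * s4 + s0 * s3 ^+ 2 - 2 * s1 * s2 * s3 + s2 ^+ 3) /
      (2 * (s1 ^+ 2 - s0 * s2) * s1 ^+ 5)
      * (T xi xb * T xib x) ^+ 2
    - 2 * (s1 * s3 - s2 ^+ 2) / s1 ^+ 4 * (T xi xb * T xib x) * km
    + s2 / s1 * km ^+ 2.
Proof.
move=> km; have nd := cost_nondegenerate Ix.
have [s10 E1 E2 E3 E4] := inverse_derivatives oI hu hs IL su Ix.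
rewrite (cross_ambient oI hu symA unitA) //.
rewrite /km (KM_cost oI hu _ _ (Ix : W (x, xb))) /= jet12_christoffel //.
rewrite /christoffel_vec /jet1122 /jet112 /jet12 !(tdotZl, tdotZr, tdotDl, tdotDr).
rewrite (tdotC xb x symA) (tdotC xib x symA) !tdot0l !tdot0r.
have := s_nondeg (IL Ix); rewrite su // !mulf_eq0 !negb_or => /andP[/andP[_ d0] _].
rewrite E1 E2 E3 E4; move: s10 d0.
move: (s 1%N _) (s 2%N _) (s 3%N _) (s 4%N _) => a1 a2 a3 a4.
move: (T x xb) (T xi xb) (T x xib) (T xi xib) => t p q r a10 d0.
have d1 : a1 ^+ 2 - t * a2 != 0 by rewrite mulrC in d0 *.
(* As a single fraction, this denominator is visibly non-zero by [d1]. *)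
have -> : a1^-1 + t * (- a2 / a1 ^+ 3) = (a1 ^+ 2 - t * a2) / a1 ^+ 3 by field.
field; by rewrite ?d1 ?a10.
Qed.

Variable nabla : (V * V -> V * V) -> (V * V -> V * V) -> V * V -> V * V.
Hypothesis nablaP : levi_civita W (KM c) nabla.
Variable O : set (V * V).
Hypotheses (oO : open O) (Op : O (x, xb)).
Local Notation N := (O `&` (M `*` M)).
Local Notation II := (second_fundamental_form (KM c) nabla (tsphere2_tangent A)).
Variables (xi xib : V) (X Y Xb Yb : V * V -> V * V).
Hypotheses (tX : tangent_field W N (tsphere2_tangent A) X)
  (tY : tangent_field W N (tsphere2_tangent A) Y)
  (tXb : tangent_field W N (tsphere2_tangent A) Xb)
  (tYb : tangent_field W N (tsphere2_tangent A) Yb)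
  (Xp : X (x, xb) = (xi, 0)) (Yp : Y (x, xb) = (xi, 0))
  (Xbp : Xb (x, xb) = (0, xib)) (Ybp : Yb (x, xb) = (0, xib)).

(** [xi] and [xib] lie in different factors, so every third derivative and every pairing in the
    formula has a zero argument. *)
Lemma second_form_mixed : II X Xb (x, xb) = 0.
Proof.
rewrite (second_fundamental_formE oI hu symA unitA eps2 Mx Mxb Ix
  (cost_nondegenerate Ix) nablaP oO Op tX tXb) Xp Xbp /=.
rewrite /jet112 !tdot0l !tdot0r.
by congr (_, _); rewrite (_ : _ - _ = 0) ?mul0r ?scale0r //; ring.
Qed.

(** The first component of II(Xb, Yb) vanishes, so the metric pairs only the multiple of [nu x xb]
    in II(X, Y) with the multiple of [nu xb x] in II(Xb, Yb), and J of these normals is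
    [normal_norm]. *)
Lemma second_form_contribution :
  KM c (x, xb) (II X Y (x, xb)) (II Xb Yb (x, xb)) =
  - 2^-1 *
    ((jet112 A u x xb xi xi 0 (normal_vec A u eps xb x) - T xi xi) *
     (jet112 A u xb x xib xib 0 (normal_vec A u eps x xb) - T xib xib) /
     normal_norm u s0).
Proof.
have nd := cost_nondegenerate Ix; have k0 := normal_norm_neq0 nd.
rewrite (second_fundamental_formE oI hu symA unitA eps2 Mx Mxb Ix nd nablaP oO Op
  tX tY) Xp Yp.
rewrite (second_fundamental_formE oI hu symA unitA eps2 Mx Mxb Ix nd nablaP oO Op
  tXb tYb) Xbp Ybp.
rewrite (KM_cost oI hu _ _ (Ix : W (x, xb))) /= !tdot0l subr0.
have := jet12_normal_snd symA (normal_vec A u eps x xb) Mx Mxb nd.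
rewrite (tdot_normal symA eps2) //.
move: (normal_vec A u eps x xb) (normal_vec A u eps xb x) => v vb vvb.
rewrite !jet12Zl !jet12Zr vvb (_ : jet112 A u x xb 0 0 0 vb = 0); last first.
  by rewrite /jet112 !tdot0l; ring.
move: (jet112 _ _ _ _ _ _ _ _) (jet112 _ _ _ _ _ _ _ _) => r r'.
move: (jet112 _ _ _ _ _ _ _ _) (normal_norm _ _) k0 => r'' k k0.
by move: (T xi xi) (T xib xib) => r1 r2; field.
Qed.

Lemma second_form_contributionE :
  KM c (x, xb) (II X Y (x, xb)) (II Xb Yb (x, xb)) =
    (- (s1 ^+ 2 - s0 * s2) * s1 ^+ 2 * T xi xi
       + eps * (s2 ^+ 2 - s3 * s1) * T xb xi ^+ 2) *
    (- (s1 ^+ 2 - s0 * s2) * s1 ^+ 2 * T xib xib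
       + eps * (s2 ^+ 2 - s3 * s1) * T x xib ^+ 2) /
    (2 * s1 ^+ 5 * (s1 ^+ 2 - s0 * s2)
       * (- s0 * s1 ^+ 2 + (s0 ^+ 2 - 1) * s2)).
Proof.
rewrite second_form_contribution.
have [s10 E1 E2 E3 _] := inverse_derivatives oI hu hs IL su Ix.
(* Tangency removes the pairings [T xi x] and [T xib xb] that the normal vectors bring into the
   jets. *)
have xix : T xi x = 0.
  have [/= _ /(_ _ (conj Op (conj Mx Mxb)))] := tX.
  by rewrite Xp => -[/(tsphere_tangentE symA)].
have xibxb : T xib xb = 0.
  have [/= _ /(_ _ (conj Op (conj Mx Mxb)))] := tXb.
  by rewrite Xbp => -[_ /(tsphere_tangentE symA)].
have := s_nondeg (IL Ix); rewrite su // !mulf_eq0 !negb_or => /andP[/andP[d0 d1] _].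
rewrite /jet112 /normal_vec /normal_norm !(tdotZr, tdotBr) !tdot0l.
rewrite (Mx : T x x = eps) (Mxb : T xb xb = eps) (tdotC xb x symA) (tdotC xb xi symA).
rewrite (tdotC xib x symA) xix xibxb E1 E2 E3; move: s10 d0 d1.
move: (s 1%N _) (s 2%N _) (s 3%N _) => a1 a2 a3.
move: (T x xb) (T xi xb) (T x xib) (T xi xi) (T xib xib) => t p q r r' a10 d0 d1.
have d2 : a1 ^+ 2 - t * a2 != 0 by rewrite mulrC in d1 *.
have d3 : - t * a1 ^+ 2 + (t ^+ 2 - 1) * a2 != 0 by rewrite [_ * a2]mulrC.
have -> : a1^-1 + t * (- a2 / a1 ^+ 3) = (a1 ^+ 2 - t * a2) / a1 ^+ 3 by field.
have -> : t * a1^-1 + (t ^+ 2 - 1) * (- a2 / a1 ^+ 3) =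
  - (- t * a1 ^+ 2 + (t ^+ 2 - 1) * a2) / a1 ^+ 3 by field.
by field; rewrite ?a10 ?d2 ?d3.
Qed.

End GaussCodazzi.

(** * Charts of the quadric and the Gauss-Codazzi equation *)

Lemma diag_mx_sym {R : realType} m (A : 'M[R]_m) : is_diag_mx A -> A^T = A.
Proof.
move=> /is_diag_mxP dA; apply/matrixP => i j; rewrite mxE.
by have [-> //|ij] := eqVneq i j; rewrite !dA // eq_sym.
Qed.

(** The openness clause, applied to [U] itself, writes the image as a subset of [M]. *)
Lemma local_coordinates_sub {R : realType} n m (M : set 'rV[R]_m)
    (U : set 'rV[R]_n) phi : local_coordinates M U phi ->
  forall z, U z -> M (phi z).
Proof.
move=> [oU _ _ _ imU] z Uz; have [B [_ E]] := imU U oU (@subset_refl _ _).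
by have [] : (B `&` M) (phi z) by rewrite -E; exists z.
Qed.

Theorem proposition7 (R : realType) (n : nat) (eps : R)
    (A : 'M[R]_n.+1) (I : set R) (u s : R -> R)
    (N : set ('rV[R]_n.+1 * 'rV[R]_n.+1))
    (nabla : ('rV[R]_n.+1 * 'rV[R]_n.+1 -> 'rV[R]_n.+1 * 'rV[R]_n.+1) ->
             ('rV[R]_n.+1 * 'rV[R]_n.+1 -> 'rV[R]_n.+1 * 'rV[R]_n.+1) ->
             'rV[R]_n.+1 * 'rV[R]_n.+1 -> 'rV[R]_n.+1 * 'rV[R]_n.+1) :
  let M := tsphere A eps in
  let c := fun x xb : 'rV[R]_n.+1 => u (tdot A x xb) in
  let W := [set p : 'rV[R]_n.+1 * 'rV[R]_n.+1 | I (tdot A p.1 p.2)] in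
  let II := second_fundamental_form (KM c) nabla (tsphere2_tangent A) in
  eps = 1 \/ eps = -1 ->
  is_diag_mx A -> A \in unitmx ->
  (exists2 lam : R, eigenvalue (eps *: A) lam & 0 < lam) ->
  open I -> is_interval I ->
  cont_diff 4 I u -> cont_diff 4 (u @` I) s ->
  (forall t, I t -> s (u t) = t) ->
  (forall v, (u @` I) v ->
     (- s v * derive1n 1 s v ^+ 2 + derive1n 2 s v * (s v ^+ 2 - 1)) *
     (derive1n 1 s v ^+ 2 - derive1n 2 s v * s v) * derive1n 1 s v != 0) ->
  (exists2 O, open O & N = O `&` (M `*` M)) ->
  N `<=` W ->
  levi_civita W (KM c) nabla ->
  forall x xb xi xib : 'rV[R]_n.+1,
  N (x, xb) ->
  tsphere2_tangent A (x, xb) (xi, xib) ->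
  let s0 := tdot A x xb in
  let s1 := derive1n 1 s (u s0) in
  let s2 := derive1n 2 s (u s0) in
  let s3 := derive1n 3 s (u s0) in
  let s4 := derive1n 4 s (u s0) in
  let km := KM c (x, xb) (xi, xib) (xi, xib) in
  cross c x xb xi xib =
    ((s1 ^+ 2 - s0 * s2) * s4 + s0 * s3 ^+ 2 - 2 * s1 * s2 * s3 + s2 ^+ 3) /
      (2 * (s1 ^+ 2 - s0 * s2) * s1 ^+ 5)
      * (tdot A xi xb * tdot A xib x) ^+ 2
    - 2 * (s1 * s3 - s2 ^+ 2) / s1 ^+ 4
      * (tdot A xi xb * tdot A xib x) * km
    + s2 / s1 * km ^+ 2 /\
  (forall X Y Xb Yb,
    tangent_field W N (tsphere2_tangent A) X ->
    tangent_field W N (tsphere2_tangent A) Y ->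
    tangent_field W N (tsphere2_tangent A) Xb ->
    tangent_field W N (tsphere2_tangent A) Yb ->
    X (x, xb) = (xi, 0) -> Y (x, xb) = (xi, 0) ->
    Xb (x, xb) = (0, xib) -> Yb (x, xb) = (0, xib) ->
    let calII := KM c (x, xb) (II X Y (x, xb)) (II Xb Yb (x, xb)) in
    [/\ forall (U Ub : set 'rV[R]_n) (phi psi : 'rV[R]_n -> 'rV[R]_n.+1)
               (y yb w wb : 'rV[R]_n),
          local_coordinates M U phi -> local_coordinates M Ub psi ->
          U y -> Ub yb -> phi y = x -> psi yb = xb ->
          'D_w phi y = xi -> 'D_wb psi yb = xib ->
          cross (fun z zb => c (phi z) (psi zb)) y yb w wb =
            cross c x xb xi xib + calII,
        calII =
          (- (s1 ^+ 2 - s0 * s2) * s1 ^+ 2 * tdot A xi xi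
             + eps * (s2 ^+ 2 - s3 * s1) * tdot A xb xi ^+ 2) *
          (- (s1 ^+ 2 - s0 * s2) * s1 ^+ 2 * tdot A xib xib
             + eps * (s2 ^+ 2 - s3 * s1) * tdot A x xib ^+ 2) /
          (2 * s1 ^+ 5 * (s1 ^+ 2 - s0 * s2)
             * (- s0 * s1 ^+ 2 + (s0 ^+ 2 - 1) * s2)),
        II X Xb (x, xb) = 0
      & KM c (x, xb) (II X Xb (x, xb)) (II X Xb (x, xb)) = 0]).
Proof.
move=> M c W II eps1 dA uA _ oI _ Cu Cs su nz [B oB NE] NW nablaP x xb xi xib Nx.
move=> tan s0 s1 s2 s3 s4 km; subst N.
have symA := diag_mx_sym dA.
have eps2 : eps ^+ 2 = 1 by case: eps1 => ->; rewrite ?sqrrN expr1n.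
have [Bp [Mx Mxb]] := Nx; have Ix : I (tdot A x xb) := NW _ Nx.
have hu := cont_diff_deriv_seq Cu; have hs := cont_diff_deriv_seq Cs.
have IL t : I t -> (u @` I) (u t) by move=> It; exists t.
have nd := cost_nondegenerate oI hu hs IL su nz Ix.
split; first exact: (cross_ambientE oI hu hs IL su nz symA uA Ix).
move=> X Y Xb Yb tX tY tXb tYb Xp Yp Xbp Ybp calII.
have mixed : II X Xb (x, xb) = 0.
  exact: (second_form_mixed oI hu hs IL su nz symA uA eps2 Mx Mxb Ix nablaP oB Bp
    tX tXb Xp Xbp).
split=> //.
- move=> U Ub phi psi y yb w wb cphi cpsi Uy Ubyb px pxb wxi wxib.
  (* Before translation into [s], the contribution is already the correction term of
     [cross_pullback]. *)
  rewrite /calII (second_form_contribution oI hu hs IL su nz symA uA eps2 Mx Mxb Ix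
    nablaP oB Bp tX tY tXb tYb Xp Yp Xbp Ybp) mulNr.
  have [oU Cphi iphi _ _] := cphi; have [oUb Cpsi ipsi _ _] := cpsi.
  apply: (cross_pullback oI hu symA uA eps2 Mx Mxb Ix nd oU oUb (Cphi 2) (Cpsi 2)
    (local_coordinates_sub cphi) (local_coordinates_sub cpsi) Uy Ubyb px pxb _ _
    wxi wxib).
    exact: iphi.
  exact: ipsi.
- exact: (second_form_contributionE oI hu hs IL su nz symA uA eps2 Mx Mxb Ix
    nablaP oB Bp tX tY tXb tYb Xp Yp Xbp Ybp).
- rewrite mixed (KM_cost oI hu _ _ (Ix : W (x, xb))) /= !jet12_0l addr0.
  by rewrite mulr0.
Qed.
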